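(* Let $(M,g)$ be a smooth $n$-dimensional Riemannian manifold, and let $J$ be the almost complex structure on the nonzero cotangent bundle $T^*_0M$ determined by a real constant $A$ and a smooth real valued function $v$ on $(0,\infty)$ as described in the context. Then $J$ is integrable if and only if the base manifold $M$ has constant sectional curvature $c$ and the function $v$ is given by $$v=\frac{c-A^2t}{At}.$$
   Context: Everything is of class $C^\infty$; indices run over $1,\dots,n$ and repeated indices are summed. $\pi:T^*M\to M$ is the cotangent bundle and $T^*_0M$ is $T^*M$ minus the zero section. A local chart $(U,x^1,\dots,x^n)$ on $M$ induces the chart $(\pi^{-1}(U),q^1,\dots,q^n,p_1,\dots,p_n)$ on $T^*M$, where $q^i=x^i\circ\pi$ and $p=p_i\,dx^i_{\pi(p)}$. Let $g_{ij}$ be the components of $g$, $(g^{ij})$ the inverse matrix, $\Gamma^k_{ij}$ the Christoffel symbols of the Levi-Civita connection of $g$, $g^{0i}=p_hg^{hi}$, $\Gamma^0_{ij}=p_k\Gamma^k_{ij}$. Set $$\frac{\delta}{\delta q^i}=\frac{\partial}{\partial q^i}+\Gamma^0_{ih}\frac{\partial}{\partial p_h};$$ the fields $\frac{\delta}{\delta q^i},\frac{\partial}{\partial p_i}$ form a local frame. Let $t=\frac12\|p\|^2=\frac12 g^{ik}p_ip_k$ be the energy density. Define $$G_{ij}=At\,g_{ij}+v(t)p_ip_j.$$ The matrix $(G_{ij})$ is positive definite if and only if $A>0$ and $A+2v>0$; this is the condition under which the construction is considered. Let $(H^{kl})$ be the inverse of $(G_{ij})$, i.e. $H^{kl}=\frac{1}{At}g^{kl}+w(t)g^{0k}g^{0l}$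 with $w=\frac{-v}{At^2(A+2v)}$. The almost complex structure $J$ is $$J\frac{\delta}{\delta q^i}=G_{ik}\frac{\partial}{\partial p_k},\qquad J\frac{\partial}{\partial p_i}=-H^{ik}\frac{\delta}{\delta q^k}.$$ Integrable means that the Nijenhuis tensor field $N(X,Y)=[JX,JY]-J[JX,Y]-J[X,JY]-[X,Y]$ vanishes. For $v=(c-A^2t)/(At)$ the positivity condition reads $A+2v=\frac{2c-A^2t}{At}>0$, $A>0$; when $c>0$ it holds on the tube $0<\|p\|^2<4c/A^2$ in $T^*_0M$.
   Formalization: The dimension n is assumed at least 2 (for n = 1 every J is integrable, whatever v is), M is nonempty, and J and the formula for v are considered only where A > 0 and A + 2v(t) > 0, a set assumed nonempty. *)

(* Defs.v *)
From HB Require Import structures.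
From mathcomp Require Import all_boot all_order all_algebra.
From mathcomp Require Import all_classical all_reals all_analysis.

Set Implicit Arguments.
Unset Strict Implicit.
Unset Printing Implicit Defensive.

Import Order.TTheory GRing.Theory Num.Theory.
Import numFieldNormedType.Exports.

Local Open Scope classical_set_scope.
Local Open Scope ring_scope.

(* Only meaningful for open U, since the derivatives are two-sided. *)
Fixpoint Ck_on (R : realType) (V W : normedModType R) (k : nat)
    (U : set V) (f : V -> W) {struct k} : Prop :=
  match k with
  | 0 => forall x, U x -> {for x, continuous f}
  | k'.+1 => (forall x, U x -> differentiable f x) /\
             (forall u : V, Ck_on k' U (fun x => 'D_u f x))
  end.

Definition smooth_on (R : realType) (V W : normedModType R)
    (U : set V) (f : V -> W) : Prop := forall k : nat, Ck_on k U f.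

(* The smooth structure is carried by an atlas (not necessarily maximal).
   Charts and their inverses are total functions; chart a is constrained on
   chart_dom a only, and chart_inv a on its image only. *)
Record smooth_manifold (R : realType) (n : nat) (M : topologicalType) := {
  chart_index : Type;
  chart_dom : chart_index -> set M;
  chart : chart_index -> M -> 'rV[R]_n;
  chart_inv : chart_index -> 'rV[R]_n -> M;
  manifold_hausdorff : hausdorff_space M;
  manifold_second_countable : @second_countable M;
  chart_dom_cover : forall x : M, exists a, chart_dom a x;
  chart_dom_open : forall a, open (chart_dom a);
  chart_image_open : forall a, open (chart a @` chart_dom a);
  chart_cancel : forall a x, chart_dom a x -> chart_inv a (chart a x) = x;
  chart_continuous :
    forall a x, chart_dom a x -> {for x, continuous (chart a)};
  chart_inv_continuous :
    forall a y, (chart a @` chart_dom a) y -> {for y, continuous (chart_inv a)};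
  transition_smooth : forall a b,
    smooth_on (chart a @` (chart_dom a `&` chart_dom b))
              (chart b \o chart_inv a)
}.

(* Entry (i, j) is d(x_b^j)/d(x_a^i) at the point x. *)
Definition transition_jacobian (R : realType) (n : nat) (M : topologicalType)
    (S : smooth_manifold R n M) (a b : chart_index S) (x : M) : 'M[R]_n :=
  jacobian (chart b \o chart_inv a) (chart a x).

Record riemannian_metric (R : realType) (n : nat) (M : topologicalType)
    (S : smooth_manifold R n M) := {
  metric_mx : chart_index S -> 'rV[R]_n -> 'M[R]_n;
  metric_smooth : forall a,
    smooth_on (chart a @` chart_dom a) (metric_mx a);
  metric_sym : forall a x, chart_dom a x ->
    (metric_mx a (chart a x))^T = metric_mx a (chart a x);
  metric_posdef : forall a x, chart_dom a x ->
    forall u : 'rV[R]_n, u != 0 ->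
      0 < (u *m metric_mx a (chart a x) *m u^T) 0 0;
  metric_change : forall a b x, chart_dom a x -> chart_dom b x ->
    metric_mx a (chart a x) =
      transition_jacobian a b x *m metric_mx b (chart b x)
        *m (transition_jacobian a b x)^T
}.

(* A point of T^*M: a base point and the components p_i of a covector in each
   chart around it, subject to the covariant transformation law.  Components
   in charts that miss the base point are normalised to 0. *)
Record cotangent (R : realType) (n : nat) (M : topologicalType)
    (S : smooth_manifold R n M) := {
  ct_base : M;
  ct_comp : chart_index S -> 'rV[R]_n;
  ct_change : forall a b, chart_dom a ct_base -> chart_dom b ct_base ->
    ct_comp a = ct_comp b *m (transition_jacobian a b ct_base)^T;
  ct_out : forall a, ~ chart_dom a ct_base -> ct_comp a = 0
}.

Definition ct_nonzero (R : realType) (n : nat) (M : topologicalType)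
    (S : smooth_manifold R n M) (P : cotangent S) : Prop :=
  exists a, ct_comp P a != 0.

(* The induced chart (q^1, ..., q^n, p_1, ..., p_n) on T^*M. *)
Definition ct_chart (R : realType) (n : nat) (M : topologicalType)
    (S : smooth_manifold R n M) (a : chart_index S) (P : cotangent S)
    : 'rV[R]_(n + n) :=
  row_mx (chart a (ct_base P)) (ct_comp P a).

(* In the rest, g : 'rV[R]_n -> 'M[R]_n is the matrix (g_ij) of the metric in
   a chart, y stands for the coordinates of a point of M, and z = (q, p) for
   those of a point of T^*M. *)

Definition partial (R : realType) (n : nat) (i : 'I_n)
    (f : 'rV[R]_n -> R^o) (y : 'rV[R]_n) : R :=
  'D_(delta_mx 0 i) f y.

(* Gamma^k_ij *)
Definition christoffel (R : realType) (n : nat) (g : 'rV[R]_n -> 'M[R]_n)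
    (k i j : 'I_n) (y : 'rV[R]_n) : R :=
  2^-1 * \sum_(h < n) invmx (g y) k h *
    (partial i (fun x => g x j h) y + partial j (fun x => g x i h) y
     - partial h (fun x => g x i j) y).

(* R(d_i, d_j) d_k = riemann g l k i j d_l *)
Definition riemann (R : realType) (n : nat) (g : 'rV[R]_n -> 'M[R]_n)
    (l k i j : 'I_n) (y : 'rV[R]_n) : R :=
  partial i (christoffel g l j k) y - partial j (christoffel g l i k) y
  + \sum_(m < n) (christoffel g l i m y * christoffel g m j k y
                  - christoffel g l j m y * christoffel g m i k y).

Definition inner (R : realType) (n : nat) (B : 'M[R]_n) (u w : 'rV[R]_n) : R :=
  (u *m B *m w^T) 0 0.

(* The vector R(u, w) w. *)
Definition curvature_op (R : realType) (n : nat) (g : 'rV[R]_n -> 'M[R]_n)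
    (y u w : 'rV[R]_n) : 'rV[R]_n :=
  \row_l \sum_(i < n) \sum_(j < n) \sum_(k < n)
    riemann g l k i j y * u 0 i * w 0 j * w 0 k.

Definition sectional_curvature (R : realType) (n : nat)
    (g : 'rV[R]_n -> 'M[R]_n) (y u w : 'rV[R]_n) : R :=
  inner (g y) (curvature_op g y u w) u /
  (inner (g y) u u * inner (g y) w w - inner (g y) u w ^+ 2).

Definition constant_sectional_curvature (R : realType) (n : nat)
    (M : topologicalType) (S : smooth_manifold R n M)
    (g : riemannian_metric S) (c : R) : Prop :=
  forall (a : chart_index S) (x : M), chart_dom a x ->
  forall u w : 'rV[R]_n, row_free (col_mx u w) ->
    sectional_curvature (metric_mx g a) (chart a x) u w = c.

(* t = g^ik p_i p_k / 2 *)
Definition energy (R : realType) (n : nat) (g : 'rV[R]_n -> 'M[R]_n)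
    (z : 'rV[R]_(n + n)) : R :=
  2^-1 * inner (invmx (g (lsubmx z))) (rsubmx z) (rsubmx z).

(* Gamma^0_ij = p_k Gamma^k_ij *)
Definition christoffel0 (R : realType) (n : nat) (g : 'rV[R]_n -> 'M[R]_n)
    (z : 'rV[R]_(n + n)) : 'M[R]_n :=
  \matrix_(i, j) \sum_(k < n) rsubmx z 0 k * christoffel g k i j (lsubmx z).

(* delta/delta q^i and d/dp_i, in the coordinate frame (d/dq, d/dp). *)
Definition delta_q (R : realType) (n : nat) (g : 'rV[R]_n -> 'M[R]_n)
    (i : 'I_n) (z : 'rV[R]_(n + n)) : 'rV[R]_(n + n) :=
  row_mx (delta_mx 0 i) (row i (christoffel0 g z)).

Definition d_p (R : realType) (n : nat) (i : 'I_n) : 'rV[R]_(n + n) :=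
  row_mx 0 (delta_mx 0 i).

(* The rows are delta/delta q^1, ..., delta/delta q^n, d/dp_1, ..., d/dp_n. *)
Definition adapted_frame (R : realType) (n : nat) (g : 'rV[R]_n -> 'M[R]_n)
    (z : 'rV[R]_(n + n)) : 'M[R]_(n + n) :=
  block_mx 1%:M (christoffel0 g z) 0 1%:M.

(* G_ij = A t g_ij + v(t) p_i p_j *)
Definition G_mx (R : realType) (n : nat) (A : R) (v : R -> R)
    (g : 'rV[R]_n -> 'M[R]_n) (z : 'rV[R]_(n + n)) : 'M[R]_n :=
  (A * energy g z) *: g (lsubmx z)
  + v (energy g z) *: ((rsubmx z)^T *m rsubmx z).

(* Tangent vectors are row vectors of components in (d/dq, d/dp).  The inner
   block matrix is that of J in the adapted frame; see J_delta_q and J_d_p. *)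
Definition J (R : realType) (n : nat) (A : R) (v : R -> R)
    (g : 'rV[R]_n -> 'M[R]_n) (z : 'rV[R]_(n + n)) (X : 'rV[R]_(n + n))
    : 'rV[R]_(n + n) :=
  X *m invmx (adapted_frame g z)
    *m block_mx 0 (G_mx A v g z) (- invmx (G_mx A v g z)) 0
    *m adapted_frame g z.

Lemma adapted_frame_unit (R : realType) (n : nat) (g : 'rV[R]_n -> 'M[R]_n)
    (z : 'rV[R]_(n + n)) : adapted_frame g z \in unitmx.
Proof. by rewrite unitmxE det_ublock !det1 mul1r unitr1. Qed.

Lemma delta_qE (R : realType) (n : nat) (g : 'rV[R]_n -> 'M[R]_n) (i : 'I_n)
    (z : 'rV[R]_(n + n)) :
  delta_q g i z = row_mx (delta_mx 0 i) 0 *m adapted_frame g z.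
Proof.
by rewrite mul_row_block mulmx1 !mul0mx !addr0 -rowE.
Qed.

Lemma d_pE (R : realType) (n : nat) (g : 'rV[R]_n -> 'M[R]_n) (i : 'I_n)
    (z : 'rV[R]_(n + n)) :
  d_p R i = row_mx 0 (delta_mx 0 i) *m adapted_frame g z.
Proof. by rewrite mul_row_block mulmx0 !mul0mx !add0r mulmx1. Qed.

Lemma row_mx0_sum (R : realType) (n : nat) (B : 'M[R]_n) (i : 'I_n) :
  row_mx (0 : 'rV[R]_n) (row i B) =
    \sum_(k < n) B i k *: row_mx (0 : 'rV[R]_n) (delta_mx 0 k).
Proof.
rewrite [row i B]row_sum_delta.
under eq_bigr => k _ do rewrite mxE.
elim/big_rec2: _ => [|k x y _ <-]; first by rewrite row_mx0.
by rewrite scale_row_mx add_row_mx scaler0 add0r.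
Qed.

Lemma row_mx_sum0 (R : realType) (n : nat) (B : 'M[R]_n) (i : 'I_n) :
  row_mx (row i B) (0 : 'rV[R]_n) =
    \sum_(k < n) B i k *: row_mx (delta_mx 0 k) (0 : 'rV[R]_n).
Proof.
rewrite [row i B]row_sum_delta.
under eq_bigr => k _ do rewrite mxE.
elim/big_rec2: _ => [|k x y _ <-]; first by rewrite row_mx0.
by rewrite scale_row_mx add_row_mx scaler0 add0r.
Qed.

Lemma J_delta_q (R : realType) (n : nat) (A : R) (v : R -> R)
    (g : 'rV[R]_n -> 'M[R]_n) (i : 'I_n) (z : 'rV[R]_(n + n)) :
  J A v g z (delta_q g i z) = \sum_(k < n) G_mx A v g z i k *: d_p R k.
Proof.
rewrite /J delta_qE mulmxK ?adapted_frame_unit// mul_row_block.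
rewrite mulmx0 !mul0mx !addr0 -rowE row_mx0_sum mulmx_suml.
by apply: eq_bigr => k _; rewrite (d_pE g k z) -scalemxAl.
Qed.

Lemma J_d_p (R : realType) (n : nat) (A : R) (v : R -> R)
    (g : 'rV[R]_n -> 'M[R]_n) (i : 'I_n) (z : 'rV[R]_(n + n)) :
  J A v g z (d_p R i) =
    - \sum_(k < n) invmx (G_mx A v g z) i k *: delta_q g k z.
Proof.
rewrite /J (d_pE g i z) mulmxK ?adapted_frame_unit// mul_row_block.
rewrite !(mulmx0, mul0mx, add0r) mulmxN -rowE -[X in row_mx _ X]oppr0.
rewrite -opp_row_mx mulNmx row_mx_sum0 mulmx_suml.
by congr (- _); apply: eq_bigr => k _; rewrite delta_qE -scalemxAl.
Qed.

Definition lie_bracket (R : realType) (m : nat)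
    (X Y : 'rV[R]_m -> 'rV[R]_m) (z : 'rV[R]_m) : 'rV[R]_m :=
  'D_(X z) Y z - 'D_(Y z) X z.

Definition nijenhuis (R : realType) (m : nat)
    (K : 'rV[R]_m -> 'rV[R]_m -> 'rV[R]_m)
    (X Y : 'rV[R]_m -> 'rV[R]_m) (z : 'rV[R]_m) : 'rV[R]_m :=
  let KX := fun x => K x (X x) in
  let KY := fun x => K x (Y x) in
  lie_bracket KX KY z - K z (lie_bracket KX Y z)
  - K z (lie_bracket X KY z) - lie_bracket X Y z.

(* The image, in the induced chart a, of the open subset of T^*_0 M on which
   (G_ij) is positive definite, i.e. A > 0 and A + 2 v(t) > 0.  J is considered
   there only: elsewhere (G_ij) may fail to be invertible. *)
Definition J_domain (R : realType) (n : nat) (M : topologicalType)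
    (S : smooth_manifold R n M) (g : riemannian_metric S)
    (A : R) (v : R -> R) (a : chart_index S) : set 'rV[R]_(n + n) :=
  [set ct_chart a P | P in [set P : cotangent S |
     [/\ chart_dom a (ct_base P), ct_nonzero P, 0 < A &
         0 < A + 2 * v (energy (metric_mx g a) (ct_chart a P))]]].

(* The Nijenhuis tensor field of J vanishes, in every induced chart. *)
Definition J_integrable (R : realType) (n : nat) (M : topologicalType)
    (S : smooth_manifold R n M) (g : riemannian_metric S)
    (A : R) (v : R -> R) : Prop :=
  forall (a : chart_index S) (X Y : 'rV[R]_(n + n) -> 'rV[R]_(n + n)),
    smooth_on (J_domain g A v a) X -> smooth_on (J_domain g A v a) Y ->
    forall z, J_domain g A v a z ->
      nijenhuis (J A v (metric_mx g a)) X Y z = 0.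

(* Main.v *)
(* In the frame delta/delta q^i, J delta/delta q^i, the Nijenhuis tensor is
   determined by N(delta/delta q^i, delta/delta q^j), because it is tensorial and
   N(JX, Y) = -J N(X, Y).  Since G is parallel along the horizontal distribution,
   the horizontal part of this value vanishes; its vertical part is the covector
     f(t) (p_i g_j - p_j g_i) - p R_ij,    f(t) = A t (A + v(t)),
   where g_j is the j-th row of g and R_ij the matrix of R(d_i, d_j).  All
   derivatives of v cancel.  The term p R_ij is linear in p, so rescaling p shows
   that f is a constant c on the set where J is defined; hence
   R_ij = c (e_i g_j - e_j g_i), i.e. constant sectional curvature c, and
   v = (c - A^2 t) / (A t).  No appeal to Schur's lemma is needed, so n = 2 is
   included.  Conversely the sectional curvature determines R by polarization. *)
Require Import Defs.
From HB Require Import structures.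
From mathcomp Require Import all_boot all_order all_algebra.
From mathcomp Require Import all_classical all_reals all_analysis.
From mathcomp Require Import perm ring lra.
Import Order.TTheory GRing.Theory Num.Theory.
Import numFieldNormedType.Exports.
Local Open Scope classical_set_scope.
Local Open Scope ring_scope.

Set Implicit Arguments.
Unset Strict Implicit.
Unset Printing Implicit Defensive.

(** * Matrix-valued differential calculus *)

(** The constant is global because f depends on the energy alone, and every ray of every cotangent
    space meets every energy level. One admissible level [t0] therefore serves all base points, even
    on different components of $M$. Integrability is tested on vector fields, while the algebra
    takes place at one point. [torsion] bridges the two: it involves only the value of J at z and
    its directional derivatives, so constant fields already detect every pair of tangent vectors,
    and the non-constant frame fields can be used to evaluate it. The converse recovers the whole
    curvature tensor from sectional curvatures, which needs the skewness of R with respect to g.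
    That skewness rests on the equality of mixed second derivatives of g, hence the calculus
    below. *)

Section MatrixCalculus.
Context {R : realType} {V : normedModType R}.

(** Lets a function be replaced by a formula valid only on an open set, as for inverses and
    Christoffel symbols. The first-order expansion of [f] is also one of [g], and uniqueness of the
    differential concludes. *)
Lemma near_differentiable (W : normedModType R) (f g : V -> W) (a : V) :
  {near a, f =1 g} -> differentiable f a -> differentiable g a.
Proof.
move=> fg df.
have H : g \o shift a = cst (g a) + 'd f a +o_ 0 id.
  apply/eqaddoP => e e0.
  have /eqaddoP/(_ e e0) := diff_locally df.
  have fg0 : \forall x \near (0 : V), f (x + a) = g (x + a).
    by move: fg; rewrite (near_shift 0) /= subr0.
  apply: filterS2 fg0 => x /= fgx.
  by rewrite -[(f \o _ - _) x]/(f (x + a) - (f a + 'd f a x)) fgx (nbhs_singleton fg).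
apply/diff_locallyP; rewrite (diff_unique (diff_continuous df) H); split; last exact: H.
exact: diff_continuous.
Qed.

Lemma differentiable_mxP m k (M : V -> 'M[R]_(m, k)) (a : V) :
  differentiable M a <-> forall i j, differentiable (fun x => M x i j : R^o) a.
Proof.
split=> [dM i j|dM].
  exact: (differentiable_comp dM (differentiable_coord _ i j)).
have -> : M = \sum_(i < m) \sum_(j < k) (fun x => M x i j *: delta_mx i j).
  apply/funext => x; rewrite [LHS]matrix_sum_delta.
  by rewrite fct_sumE; apply: eq_bigr => i _; rewrite fct_sumE.
apply: differentiable_sum => i; apply: differentiable_sum => j.
exact: differentiableZl.
Qed.

Lemma derive_mxE m k (M : V -> 'M[R]_(m, k)) (a v : V) i j :
  differentiable M a -> 'D_v M a i j = 'D_v (fun x => M x i j : R^o) a.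
Proof. by move=> dM; rewrite derive_mx ?mxE//; exact: diff_derivable. Qed.

Lemma differentiable_mulmx m k l (M : V -> 'M[R]_(m, k)) (N : V -> 'M[R]_(k, l)) a :
  differentiable M a -> differentiable N a ->
  differentiable (fun x => M x *m N x) a.
Proof.
move=> /differentiable_mxP dM /differentiable_mxP dN.
apply/differentiable_mxP => i j.
have -> : (fun x => (M x *m N x) i j : R^o)
  = \sum_h (fun x => M x i h * N x h j).
  by apply/funext => x; rewrite mxE fct_sumE.
by apply: differentiable_sum => h; apply: differentiableM.
Qed.

Lemma derive_mulmx m k l (M : V -> 'M[R]_(m, k)) (N : V -> 'M[R]_(k, l)) a v :
  differentiable M a -> differentiable N a ->
  'D_v (fun x => M x *m N x) a = 'D_v M a *m N a + M a *m 'D_v N a.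
Proof.
move=> dM dN; apply/matrixP => i j.
rewrite derive_mxE; last exact: differentiable_mulmx.
have -> : (fun x => (M x *m N x) i j : R^o)
  = \sum_h (fun x => M x i h * N x h j).
  by apply/funext => x; rewrite mxE fct_sumE.
have /differentiable_mxP dM' := dM; have /differentiable_mxP dN' := dN.
rewrite derive_sum; last first.
  by move=> h; apply: diff_derivable; apply: differentiableM.
rewrite !mxE -big_split; apply: eq_bigr => h _ /=.
rewrite (deriveM (diff_derivable (dM' i h)) (diff_derivable (dN' h j))).
by rewrite !derive_mxE// addrC /GRing.scale/= [X in _ + X]mulrC [X in X + _]mulrC.
Qed.

Lemma differentiable_scalemx m k (f : V -> R^o) (M : V -> 'M[R]_(m, k)) a :
  differentiable f a -> differentiable M a ->
  differentiable (fun x => f x *: M x) a.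
Proof.
move=> df /differentiable_mxP dM; apply/differentiable_mxP => i j.
have -> : (fun x => (f x *: M x) i j : R^o) = f * (fun x => M x i j).
  by apply/funext => x; rewrite mxE.
exact: differentiableM.
Qed.

Lemma derive_scalemx m k (f : V -> R^o) (M : V -> 'M[R]_(m, k)) a v :
  differentiable f a -> differentiable M a ->
  'D_v (fun x => f x *: M x) a = 'D_v f a *: M a + f a *: 'D_v M a.
Proof.
move=> df dM; apply/matrixP => i j.
rewrite derive_mxE; last exact: differentiable_scalemx.
have -> : (fun x => (f x *: M x) i j : R^o) = f * (fun x => M x i j).
  by apply/funext => x; rewrite mxE.
have /differentiable_mxP dM' := dM.
rewrite (deriveM (diff_derivable df) (diff_derivable (dM' i j))) !mxE.
by rewrite !derive_mxE// [RHS]addrC [X in _ = _ + X]mulrC.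
Qed.

Lemma differentiable_mxsub m k m' k' (r : 'I_m' -> 'I_m) (c : 'I_k' -> 'I_k)
    (M : V -> 'M[R]_(m, k)) a :
  differentiable M a -> differentiable (fun x => mxsub r c (M x)) a.
Proof.
move=> /differentiable_mxP dM; apply/differentiable_mxP => i j.
have -> : (fun x => mxsub r c (M x) i j : R^o) = (fun x => M x (r i) (c j)).
  by apply/funext => x; rewrite mxE.
exact: dM.
Qed.

Lemma derive_mxsub m k m' k' (r : 'I_m' -> 'I_m) (c : 'I_k' -> 'I_k)
    (M : V -> 'M[R]_(m, k)) a v :
  differentiable M a -> 'D_v (fun x => mxsub r c (M x)) a = mxsub r c ('D_v M a).
Proof.
move=> dM; apply/matrixP => i j.
rewrite derive_mxE; last exact: differentiable_mxsub.
rewrite mxE derive_mxE//; congr ('D_v _ a).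
by apply/funext => x; rewrite mxE.
Qed.

Lemma differentiable_trmx m k (M : V -> 'M[R]_(m, k)) a :
  differentiable M a -> differentiable (fun x => (M x)^T) a.
Proof.
move=> /differentiable_mxP dM; apply/differentiable_mxP => i j.
have -> : (fun x => (M x)^T i j : R^o) = (fun x => M x j i).
  by apply/funext => x; rewrite mxE.
exact: dM.
Qed.

Lemma derive_trmx m k (M : V -> 'M[R]_(m, k)) a v :
  differentiable M a -> 'D_v (fun x => (M x)^T) a = ('D_v M a)^T.
Proof.
move=> dM; apply/matrixP => i j.
rewrite derive_mxE; last exact: differentiable_trmx.
rewrite mxE derive_mxE//; congr ('D_v _ a).
by apply/funext => x; rewrite mxE.
Qed.

Lemma differentiable_block_mx m1 m2 k1 k2 (M1 : V -> 'M[R]_(m1, k1))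
    (M2 : V -> 'M[R]_(m1, k2)) (M3 : V -> 'M[R]_(m2, k1))
    (M4 : V -> 'M[R]_(m2, k2)) a :
  differentiable M1 a -> differentiable M2 a ->
  differentiable M3 a -> differentiable M4 a ->
  differentiable (fun x => block_mx (M1 x) (M2 x) (M3 x) (M4 x)) a.
Proof.
move=> /differentiable_mxP d1 /differentiable_mxP d2.
move=> /differentiable_mxP d3 /differentiable_mxP d4.
apply/differentiable_mxP => i j.
case: (split_ordP i) => i' ->; case: (split_ordP j) => j' ->.
- rewrite (_ : (fun x => _) = (fun x => M1 x i' j')) ?d1//.
  by apply/funext => x; rewrite block_mxEul.
- rewrite (_ : (fun x => _) = (fun x => M2 x i' j')) ?d2//.
  by apply/funext => x; rewrite block_mxEur.
- rewrite (_ : (fun x => _) = (fun x => M3 x i' j')) ?d3//.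
  by apply/funext => x; rewrite block_mxEdl.
- rewrite (_ : (fun x => _) = (fun x => M4 x i' j')) ?d4//.
  by apply/funext => x; rewrite block_mxEdr.
Qed.

Lemma differentiable_row_mx m k1 k2 (M1 : V -> 'M[R]_(m, k1))
    (M2 : V -> 'M[R]_(m, k2)) a :
  differentiable M1 a -> differentiable M2 a ->
  differentiable (fun x => row_mx (M1 x) (M2 x)) a.
Proof.
move=> /differentiable_mxP d1 /differentiable_mxP d2.
apply/differentiable_mxP => i j; case: (split_ordP j) => j' ->.
- rewrite (_ : (fun x => _) = (fun x => M1 x i j')) ?d1//.
  by apply/funext => x; rewrite row_mxEl.
- rewrite (_ : (fun x => _) = (fun x => M2 x i j')) ?d2//.
  by apply/funext => x; rewrite row_mxEr.
Qed.

Lemma derive_row_mx m k1 k2 (M1 : V -> 'M[R]_(m, k1))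
    (M2 : V -> 'M[R]_(m, k2)) a v :
  differentiable M1 a -> differentiable M2 a ->
  'D_v (fun x => row_mx (M1 x) (M2 x)) a = row_mx ('D_v M1 a) ('D_v M2 a).
Proof.
move=> d1 d2; apply/matrixP => i j.
rewrite derive_mxE; last exact: differentiable_row_mx.
case: (split_ordP j) => j' ->.
- rewrite row_mxEl derive_mxE//; congr ('D_v _ a).
  by apply/funext => x; rewrite row_mxEl.
- rewrite row_mxEr derive_mxE//; congr ('D_v _ a).
  by apply/funext => x; rewrite row_mxEr.
Qed.

Lemma differentiable_det m (M : V -> 'M[R]_m) a :
  differentiable M a -> differentiable (fun x => \det (M x) : R^o) a.
Proof.
move=> /differentiable_mxP dM; rewrite /determinant.
pose F (s : 'S_m) : V -> R^o := (fun=> (-1) ^+ s) * \prod_i (fun x => M x i (s i)).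
have -> : (fun x => \sum_(s : 'S_m) (-1) ^+ s * \prod_i M x i (s i) : R^o) =
    \sum_(s : 'S_m) F s.
  apply/funext => x; rewrite fct_sumE; apply: eq_bigr => s _.
  by rewrite -[RHS]/(_ * _); congr (_ * _); rewrite fct_prodE.
elim/big_ind : _ => // [f h df dh|s _]; first exact: differentiableD.
apply: differentiableM; first exact: differentiable_cst.
by elim/big_ind : _ => // f h df dh; exact: differentiableM.
Qed.

Lemma near_unitmx m (M : V -> 'M[R]_m) a :
  differentiable M a -> M a \in unitmx -> \forall x \near a, M x \in unitmx.
Proof.
move=> dM; rewrite unitmxE unitfE => Ma.
have /cvgr_neq0/(_ Ma) := differentiable_continuous (differentiable_det dM).
by apply: filterS => x /=; rewrite unitmxE unitfE.
Qed.

Lemma differentiable_invmx m (M : V -> 'M[R]_m) a :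
  differentiable M a -> M a \in unitmx -> differentiable (fun x => invmx (M x)) a.
Proof.
move=> dM Ma.
(* Cramer's formula holds near [a] because the determinant stays nonzero there; its entries are
   polynomials in those of [M] divided by the determinant. *)
apply: (@near_differentiable _ (fun x => (\det (M x))^-1 *: \adj (M x))).
  by apply: filterS (near_unitmx dM Ma) => x Mx; rewrite /invmx Mx.
apply: differentiable_scalemx.
  apply: differentiableV; first exact: differentiable_det.
  by move: Ma; rewrite unitmxE unitfE.
apply/differentiable_mxP => i j.
have -> : (fun x => \adj (M x) i j : R^o) = fun x =>
   (-1) ^+ (j + i) * \det (row' j (col' i (M x))).
  by apply/funext => x; rewrite mxE.
apply: differentiableM; first exact: differentiable_cst.
by apply: differentiable_det; rewrite /row' /col'; do 2![apply: differentiable_mxsub].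
Qed.

Lemma derive_invmx m (M : V -> 'M[R]_m) a v :
  differentiable M a -> M a \in unitmx ->
  'D_v (fun x => invmx (M x)) a = - (invmx (M a) *m 'D_v M a *m invmx (M a)).
Proof.
move=> dM Ma; have dN := differentiable_invmx dM Ma.
have : 'D_v (fun x => invmx (M x) *m M x) a = 0.
  rewrite (@near_eq_derive _ _ _ _ (cst 1%:M)) ?derive_cst//.
  by apply: filterS (near_unitmx dM Ma) => x Mx; rewrite mulVmx.
rewrite derive_mulmx// => /(congr1 (mulmx^~ (invmx (M a)))).
by rewrite mulmxDl mulmxK// mul0mx => /eqP; rewrite addr_eq0 => /eqP.
Qed.

End MatrixCalculus.

(** * Symmetry of mixed second derivatives *)

Section MixedDerivatives.
Context {R : realType} {V : normedModType R}.
Implicit Types (f : V -> R^o) (a u v : V).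

Lemma is_derive_line f a u (x : R) :
  derivable f (a + x *: u) u ->
  is_derive x (1 : R) (fun y : R => f (a + y *: u) : R^o) ('D_u f (a + x *: u)).
Proof.
have E : (fun h : R => h^-1 *: (f (a + (h *: (1 : R^o) + x) *: u) - f (a + x *: u))) =
         (fun h : R => h^-1 *: (f (h *: u + (a + x *: u)) - f (a + x *: u))).
  apply/funext => h; congr (_ *: (f _ - _)).
  by rewrite [h *: _]mulr1 scalerDl addrCA.
move=> df; split; first by rewrite /derivable/= E.
by rewrite /derive/= E.
Qed.

Lemma MVT_line f a u (s : R) : 0 < s ->
  (forall x : R, 0 <= x <= s -> derivable f (a + x *: u) u) ->
  exists2 x : R, 0 <= x <= s & f (a + s *: u) - f a = s * 'D_u f (a + x *: u).
Proof.
move=> s0 df.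
have [||x xs] := @MVT R (fun y => f (a + y *: u)) (fun y => 'D_u f (a + y *: u)) 0 s s0.
- move=> x; rewrite in_itv/= => /andP[/ltW x0 /ltW xs].
  by apply: is_derive_line; apply: df; rewrite x0.
- apply/continuous_in_subspaceT => x; rewrite inE/= in_itv/= => xs.
  apply: differentiable_continuous; apply/derivable1_diffP.
  by apply: ex_derive; apply: is_derive_line; exact: df.
rewrite scale0r addr0 subr0 mulrC => E; exists x => //.
by move: xs; rewrite in_itv/= => /andP[/ltW -> /ltW ->].
Qed.

(** The mean value theorem used twice: on the increment [h] of [f] by [s *: v], along [u], and then
    on the derivative of [f] in direction [u], along [v]. *)
Lemma mixed_difference f a u v (s : R) : 0 < s ->
  (forall x y : R, 0 <= x <= s -> 0 <= y <= s ->
     derivable f (a + x *: u + y *: v) u /\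
     derivable (fun b => 'D_u f b : R^o) (a + x *: u + y *: v) v) ->
  exists x y : R, [/\ 0 <= x <= s, 0 <= y <= s &
    f (a + s *: u + s *: v) - f (a + s *: u) - f (a + s *: v) + f a =
    s * (s * 'D_v (fun b => 'D_u f b : R^o) (a + x *: u + y *: v))].
Proof.
move=> s0 df; pose h b := f (b + s *: v) - f b.
have dsh b : derivable f (b + s *: v) u ->
    is_derive b u (fun c => f (c + s *: v) : R^o) ('D_u f (b + s *: v)).
  have E : (fun k : R => k^-1 *: (f (k *: u + b + s *: v) - f (b + s *: v))) =
         (fun k : R => k^-1 *: (f (k *: u + (b + s *: v)) - f (b + s *: v))).
    by apply/funext => k; rewrite addrA.
  by move=> dfb; split; [rewrite /derivable E|rewrite /derive E].
have ss : 0 <= s <= s by rewrite (ltW s0) lexx.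
have z0 : 0 <= (0 : R) <= s by rewrite lexx ltW.
have dh (x : R) : 0 <= x <= s -> is_derive (a + x *: u) u h
    ('D_u f (a + x *: u + s *: v) - 'D_u f (a + x *: u)).
  move=> xs; have [d1 _] := df x s xs ss; have [d2 _] := df x 0 xs z0.
  rewrite scale0r addr0 in d2.
  exact: (is_deriveB (dsh _ d1) (derivableP d2)).
have [x xs E] := MVT_line s0 (fun x xs => @ex_derive _ _ _ _ _ _ _ (dh x xs)).
have [_ Eh] := dh x xs; rewrite Eh in E.
have [y ys Ey] := @MVT_line (fun b => 'D_u f b) (a + x *: u) v s s0
  (fun y ys => (df x y xs ys).2).
exists x, y; split => //; rewrite -Ey -E /h.
by rewrite opprD opprK addrA.
Qed.

(** The second difference of [f] over a parallelogram is symmetric in [u] and [v], so each mixed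
    derivative takes a common value somewhere in a small parallelogram; continuity brings both
    values back to [a]. *)
Lemma derive_swap f a u v :
  (\forall b \near a, derivable f b u /\ derivable (fun b => 'D_u f b : R^o) b v) ->
  (\forall b \near a, derivable f b v /\ derivable (fun b => 'D_v f b : R^o) b u) ->
  {for a, continuous (fun b => 'D_v (fun b => 'D_u f b : R^o) b : R^o)} ->
  {for a, continuous (fun b => 'D_u (fun b => 'D_v f b : R^o) b : R^o)} ->
  'D_v (fun b => 'D_u f b : R^o) a = 'D_u (fun b => 'D_v f b : R^o) a.
Proof.
move=> nu nv cu cv; apply/eqP; rewrite -subr_eq0 -normr_le0; apply/ler_addgt0Pl => e e0.
rewrite addr0.
have e2 : 0 < e / 2 by rewrite divr_gt0.
have /nbhs_ballP[d /= d0 good] : \forall b \near a,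
   [/\ derivable f b u /\ derivable (fun b => 'D_u f b : R^o) b v,
       derivable f b v /\ derivable (fun b => 'D_v f b : R^o) b u,
       `|'D_v (fun b => 'D_u f b : R^o) a - 'D_v (fun b => 'D_u f b : R^o) b| < e / 2 &
       `|'D_u (fun b => 'D_v f b : R^o) a - 'D_u (fun b => 'D_v f b : R^o) b| < e / 2].
  have cu' : \forall b \near a,
     `|'D_v (fun b => 'D_u f b : R^o) a - 'D_v (fun b => 'D_u f b : R^o) b| < e / 2.
    by move/cvgrPdist_lt : cu; apply.
  have cv' : \forall b \near a,
     `|'D_u (fun b => 'D_v f b : R^o) a - 'D_u (fun b => 'D_v f b : R^o) b| < e / 2.
    by move/cvgrPdist_lt : cv; apply.
  apply: filterS2 (filterI nu nv) (filterI cu' cv') => b [? ?] [? ?].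
  by split.
(* This size keeps the parallelogram with sides [s *: u] and [s *: v] inside the ball of radius [d];
   the summand 1 keeps the denominator positive when [u] and [v] vanish. *)
pose s := d / (2 * (1 + `|u| + `|v|)).
have N0 : 0 < 1 + `|u| + `|v| by rewrite ltr_wpDr// ltr_wpDr.
have s0 : 0 < s by rewrite divr_gt0// mulr_gt0.
have inb (x y : R) : 0 <= x <= s -> 0 <= y <= s -> ball a d (a + x *: u + y *: v).
  move=> /andP[x0 xs] /andP[y0 ys]; rewrite -ball_normE /ball_/=.
  rewrite -addrA opprD addNKr normrN.
  apply: (@le_lt_trans _ _ (s * (`|u| + `|v|))).
    rewrite mulrDr (le_trans (ler_normD _ _))// !normrZ !ger0_norm//.
    by rewrite lerD// ler_wpM2r.
  have -> : d = s * (2 * (1 + `|u| + `|v|)).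
    by rewrite /s divfK// gt_eqF// mulr_gt0.
  rewrite ltr_pM2l//.
  by have := normr_ge0 u; have := normr_ge0 v; lra.
have inb' (x y : R) : 0 <= x <= s -> 0 <= y <= s -> ball a d (a + y *: v + x *: u).
  by move=> xs ys; rewrite addrAC; exact: inb.
have [|x [y [xs ys E]]] := @mixed_difference f a u v s s0.
  by move=> x y xs ys; have [] := good _ (inb _ _ xs ys).
have [|x' [y' [xs' ys' E']]] := @mixed_difference f a v u s s0.
  by move=> x1 y1 xs1 ys1; have [] := good _ (inb' _ _ ys1 xs1).
have [_ _ B _] := good _ (inb _ _ xs ys).
have [_ _ _ B'] := good _ (inb' _ _ ys' xs').
have EE : 'D_v (fun b => 'D_u f b : R^o) (a + x *: u + y *: v) =
          'D_u (fun b => 'D_v f b : R^o) (a + x' *: v + y' *: u).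
  apply: (mulfI (lt0r_neq0 s0)); apply: (mulfI (lt0r_neq0 s0)).
  apply: etrans (esym E) _; apply: etrans E'; rewrite (addrAC a (s *: u)).
  by congr (_ + _); exact: addrAC.
rewrite EE in B; move: B B'; set w := 'D_u _ (_ + _) => B B'.
apply: le_trans (ler_distD w _ _) _; rewrite [e]splitr; apply: lerD; first exact: ltW B.
by rewrite distrC; exact: ltW B'.
Qed.

End MixedDerivatives.

(** * The Levi-Civita connection in a chart *)

Section SmoothOn.
Context {R : realType} {V W : normedModType R} (U : set V) (f : V -> W).
Hypothesis f_smooth : smooth_on U f.

Lemma smooth_on_differentiable x : U x -> differentiable f x.
Proof. by have [+ _] := f_smooth 1%N; exact. Qed.

Lemma smooth_on_derive u : smooth_on U (fun x => 'D_u f x).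
Proof. by move=> k; have [_] := f_smooth k.+1; exact. Qed.

End SmoothOn.

Lemma posdef_unitmx (R : realType) n (B : 'M[R]_n) :
  (forall u : 'rV[R]_n, u != 0 -> 0 < (u *m B *m u^T) 0 0) -> B \in unitmx.
Proof.
move=> Bpos; rewrite -row_free_unit -kermx_eq0; apply/eqP/row_matrixP => i.
apply/eqP; rewrite row0; apply: contraT => /Bpos.
by rewrite -row_mul mulmx_ker row0 mul0mx mxE ltxx.
Qed.

(** The algebra behind the skewness of R(d_i, d_j): [A] and [B] stand for the Christoffel matrices
    of i and j, [P] and [Q] for the derivatives d_i of [B] and d_j of [A]. The hypothesis equates
    the two second derivatives of the metric. *)
Lemma curvature_antisym_mx (R : realType) n (G P Q A B : 'M[R]_n) : G^T = G ->
  (G *m A + A^T *m G) *m B + G *m P + (P^T *m G + B^T *m (G *m A + A^T *m G)) =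
  (G *m B + B^T *m G) *m A + G *m Q + (Q^T *m G + A^T *m (G *m B + B^T *m G)) ->
  (P - Q + (A *m B - B *m A))^T *m G + G *m (P - Q + (A *m B - B *m A)) = 0.
Proof.
move=> GT.
have -> : (P - Q + (A *m B - B *m A))^T = P^T - Q^T + (B^T *m A^T - A^T *m B^T).
  rewrite -!trmx_mul; apply/matrixP => k l; move: (A *m B) (B *m A) => X Y.
  by rewrite !mxE.
rewrite !mulmxDl !mulmxDr !mulmxN !mulNmx !mulmxA.
move: (G *m A *m B) (A^T *m G *m B) (G *m P) (P^T *m G) (B^T *m G *m A).
move: (B^T *m A^T *m G) (G *m B *m A) (G *m Q) (Q^T *m G) (A^T *m B^T *m G).
move=> X1 X2 X3 X4 X5 X6 X7 X8 X9 X10 /matrixP E; apply/matrixP => k l.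
by move: (E k l); rewrite !mxE; lra.
Qed.

Section LeviCivita.
Context {R : realType} {n : nat} (g : 'rV[R]_n -> 'M[R]_n) (U : set 'rV[R]_n).
Hypothesis U_open : open U.
Hypothesis g_smooth : smooth_on U g.
Hypothesis g_sym : forall y, U y -> (g y)^T = g y.
Hypothesis g_posdef : forall y, U y -> forall u : 'rV[R]_n, u != 0 ->
  0 < (u *m g y *m u^T) 0 0.

(** The upper index labels the rows, so that covectors multiply on the left and curvature becomes
    d_i Gamma_j - d_j Gamma_i plus a matrix commutator. *)
Definition christoffel_mx (i : 'I_n) (y : 'rV[R]_n) : 'M[R]_n :=
  \matrix_(k, j) christoffel g k i j y.

Definition riemann_mx (i j : 'I_n) (y : 'rV[R]_n) : 'M[R]_n :=
  \matrix_(k, h) riemann g k h i j y.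

Local Notation e_ i := (delta_mx 0 i : 'rV[R]_n).
Local Notation "''d_' i f" := (fun y => 'D_(e_ i) f y)
  (at level 10, i at next level, f at next level).

Lemma near_U y : U y -> \forall x \near y, U x.
Proof. by move=> Uy; exact: open_nbhs_nbhs. Qed.

Lemma metric_unit y : U y -> g y \in unitmx.
Proof. by move=> /g_posdef; exact: posdef_unitmx. Qed.

Let g_diff y : U y -> differentiable g y.
Proof. exact: smooth_on_differentiable. Qed.

Let dg_diff u y : U y -> differentiable (fun y => 'D_u g y) y.
Proof. by apply: smooth_on_differentiable; exact: smooth_on_derive. Qed.

Lemma metricC y i j : U y -> g y i j = g y j i.
Proof. by move=> /g_sym {1}<-; rewrite mxE. Qed.

Lemma derive_metricC y u i j : U y -> 'D_u g y i j = 'D_u g y j i.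
Proof.
move=> Uy; rewrite !derive_mxE; [|exact: g_diff..].
apply: near_eq_derive; apply: filterS (near_U Uy) => x Ux /=.
exact: metricC.
Qed.

(* Names the derivatives: rewriting with derive_metricC makes unification unfold them. *)
Lemma derive_metric_family y : U y -> exists D : 'I_n -> 'M[R]_n,
  (forall i, 'D_(e_ i) g y = D i) /\ (forall i a b, D i a b = D i b a).
Proof.
move=> Uy; exists (fun i => 'D_(e_ i) g y); split=> // i a b.
exact: derive_metricC.
Qed.

(** Christoffel symbols of the first kind, with the lowered index l labelling the rows. *)
Definition christoffel1_mx (i : 'I_n) (y : 'rV[R]_n) : 'M[R]_n :=
  2^-1 *: \matrix_(l, j) ('d_i g y l j + 'd_j g y i l - 'd_l g y i j).

Lemma christoffel_mxE i y : U y ->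
  christoffel_mx i y = invmx (g y) *m christoffel1_mx i y.
Proof.
move=> Uy; rewrite -scalemxAr; apply/matrixP => k j; rewrite !mxE; congr (_ * _).
apply: eq_bigr => h _; rewrite mxE; congr (_ * (_ + _ - _)).
- by rewrite derive_metricC// derive_mxE//; exact: g_diff.
- by rewrite derive_mxE//; exact: g_diff.
- by rewrite derive_mxE//; exact: g_diff.
Qed.

Lemma metric_christoffel_mx i y : U y ->
  g y *m christoffel_mx i y = christoffel1_mx i y.
Proof.
by move=> Uy; rewrite christoffel_mxE// mulKVmx//; exact: metric_unit.
Qed.

(** Compatibility of the Levi-Civita connection with the metric: after lowering the index, the sum
    of the two first-kind symbols leaves only the i-th derivative of g. *)
Lemma derive_metric i y : U y ->
  'D_(e_ i) g y = g y *m christoffel_mx i y + (christoffel_mx i y)^T *m g y.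
Proof.
move=> Uy; have -> : (christoffel_mx i y)^T *m g y = (christoffel1_mx i y)^T.
  by rewrite -metric_christoffel_mx// trmx_mul g_sym.
rewrite metric_christoffel_mx//; apply/matrixP => l j; rewrite !mxE.
have [D [DE DC]] := derive_metric_family Uy.
by rewrite !DE (DC i j l) (DC j i l) (DC l i j); lra.
Qed.

Lemma christoffelC k i j y : U y -> christoffel g k i j y = christoffel g k j i y.
Proof.
move=> Uy; congr (_ * _); apply: eq_bigr => h _; congr (_ * _).
have E a b c : partial a (fun x => g x b c) y = 'D_(e_ a) g y b c.
  by rewrite derive_mxE//; exact: g_diff.
have [D [DE DC]] := derive_metric_family Uy.
by rewrite !E !DE (DC h i j) [X in X - _]addrC.
Qed.

Lemma christoffel_mx_diff i y : U y -> differentiable (christoffel_mx i) y.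
Proof.
move=> Uy; apply: (@near_differentiable _ _ _ (fun y => invmx (g y) *m christoffel1_mx i y)).
  by apply: filterS (near_U Uy) => x Ux; rewrite christoffel_mxE.
apply: differentiable_mulmx.
  by apply: differentiable_invmx; [exact: g_diff|exact: metric_unit].
apply: differentiable_scalemx; first exact: differentiable_cst.
have H a b c : differentiable (fun y => 'd_a g y b c : R^o) y.
  by have /differentiable_mxP := dg_diff (e_ a) Uy; apply.
apply/differentiable_mxP => l j.
have -> : (fun x =>
    (\matrix_(l, j) ('d_i g x l j + 'd_j g x i l - 'd_l g x i j)) l j : R^o)
  = (fun x => 'd_i g x l j) + (fun x => 'd_j g x i l) - (fun x => 'd_l g x i j).
  by apply/funext => x; rewrite mxE.
exact: (differentiableB (differentiableD (H _ _ _) (H _ _ _)) (H _ _ _)).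
Qed.

Lemma riemann_mxE i j y : U y -> riemann_mx i j y =
  'D_(e_ i) (christoffel_mx j) y - 'D_(e_ j) (christoffel_mx i) y
  + (christoffel_mx i y *m christoffel_mx j y
     - christoffel_mx j y *m christoffel_mx i y).
Proof.
move=> Uy; apply/matrixP => k h.
have E a b : partial a (christoffel g k b h) y = 'D_(e_ a) (christoffel_mx b) y k h.
  rewrite derive_mxE; last exact: christoffel_mx_diff.
  have -> // : (fun x => christoffel_mx b x k h : R^o) = christoffel g k b h.
  by apply/funext => x; rewrite mxE.
rewrite mxE /riemann !E [RHS]mxE; congr (_ + _); first by rewrite !mxE.
rewrite sumrB [RHS]mxE [X in _ = _ + X]mxE 2![in RHS]mxE.
by congr (_ - _); apply: eq_bigr => m _; rewrite !mxE.
Qed.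

Lemma riemannC k h i j y : riemann g k h j i y = - riemann g k h i j y.
Proof.
rewrite /riemann opprD opprB; congr (_ + _).
by rewrite -sumrN; apply: eq_bigr => m _; rewrite opprB.
Qed.

Lemma derive2_metricC u v y : U y ->
  'D_v (fun x => 'D_u g x) y = 'D_u (fun x => 'D_v g x) y.
Proof.
move=> Uy; apply/matrixP => a b.
have E u' v' x : U x -> 'D_v' (fun x => 'D_u' g x) x a b =
   'D_v' (fun x => 'D_u' (fun x => g x a b : R^o) x : R^o) x.
  move=> Ux; rewrite derive_mxE; last exact: dg_diff.
  apply: near_eq_derive; apply: filterS (near_U Ux) => x' Ux' /=.
  by rewrite derive_mxE//; exact: g_diff.
have D u' v' : \forall x \near y, derivable (fun x => g x a b : R^o) x u' /\
   derivable (fun x => 'D_u' (fun x => g x a b : R^o) x : R^o) x v'.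
  apply: filterS (near_U Uy) => x Ux; split.
    by apply: diff_derivable; have /differentiable_mxP := g_diff Ux; apply.
  apply: (@near_eq_derivable _ _ _ (fun x => 'D_u' g x a b)).
    apply: filterS (near_U Ux) => x' Ux' /=.
    by rewrite derive_mxE//; exact: g_diff.
  by apply: diff_derivable; have /differentiable_mxP := dg_diff u' Ux; apply.
have C u' v' : {for y, continuous
    (fun x => 'D_v' (fun x => 'D_u' (fun x => g x a b : R^o) x : R^o) x : R^o)}.
  apply: differentiable_continuous.
  apply: (@near_differentiable _ _ _ (fun x => 'D_v' (fun x => 'D_u' g x) x a b)).
    by apply: filterS (near_U Uy) => x Ux; exact: E.
  have : differentiable (fun x => 'D_v' (fun x => 'D_u' g x) x) y.
    by apply: smooth_on_differentiable Uy; do 2!apply: smooth_on_derive.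
  by move/differentiable_mxP; apply.
apply: etrans (E u v y Uy) _; apply: etrans (esym (E v u y Uy)).
exact: (derive_swap (D u v) (D v u) (C u v) (C v u)).
Qed.

(* Differentiate d_j g = g Gamma_j + Gamma_j^T g once more and use the symmetry of
   the second derivatives of g. *)
Lemma riemann_mx_antisym i j y : U y ->
  (g y *m riemann_mx i j y)^T = - (g y *m riemann_mx i j y).
Proof.
move=> Uy; rewrite (riemann_mxE i j Uy).
have dd a b : 'D_(e_ a) (fun x => 'D_(e_ b) g x) y =
   (g y *m christoffel_mx a y + (christoffel_mx a y)^T *m g y) *m christoffel_mx b y
   + g y *m 'D_(e_ a) (christoffel_mx b) y +
   (('D_(e_ a) (christoffel_mx b) y)^T *m g y
     + (christoffel_mx b y)^T
       *m (g y *m christoffel_mx a y + (christoffel_mx a y)^T *m g y)).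
  rewrite -derive_metric//.
  rewrite (@near_eq_derive _ _ _ _
    (fun x => g x *m christoffel_mx b x + (christoffel_mx b x)^T *m g x)).
    have dC := christoffel_mx_diff b Uy; have dg := g_diff Uy.
    have dCT := differentiable_trmx dC.
    apply: etrans (@deriveD _ _ _ (fun x => g x *m christoffel_mx b x)
      (fun x => (christoffel_mx b x)^T *m g x) y (e_ a) _ _) _.
    - by apply: diff_derivable; exact: differentiable_mulmx.
    - by apply: diff_derivable; exact: differentiable_mulmx.
    by rewrite !derive_mulmx// derive_trmx.
  by apply: filterS (near_U Uy) => x Ux; rewrite derive_metric.
have := etrans (esym (dd i j)) (etrans (derive2_metricC (e_ j) (e_ i) Uy) (dd j i)).
move=> /(curvature_antisym_mx (g_sym Uy)) H.
apply/eqP; rewrite -addr_eq0 trmx_mul g_sym//; exact/eqP.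
Qed.

Lemma riemann_bianchi k h i j y : U y ->
  riemann g k h i j y + riemann g k i j h y + riemann g k j h i y = 0.
Proof.
move=> Uy.
(* [X] collects the derivatives of the Christoffel symbols and [Z] their products. The connection
   has no torsion, so both are symmetric in their last two indices and the cyclic sum cancels in
   pairs. *)
have [X [Z [E XC ZC]]] : exists X Z : 'I_n -> 'I_n -> 'I_n -> R,
  [/\ forall h i j, riemann g k h i j y = X i j h - X j i h + (Z i j h - Z j i h),
      forall a b c, X a b c = X a c b & forall a b c, Z a b c = Z a c b].
  exists (fun a b c => partial a (christoffel g k b c) y).
  exists (fun a b c => \sum_m christoffel g k a m y * christoffel g m b c y).
  split=> [h' i' j'|a b c|a b c]; first by rewrite /riemann sumrB.
  - apply: near_eq_derive; apply: filterS (near_U Uy) => x Ux.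
    exact: christoffelC.
  - by apply: eq_bigr => m _; rewrite (christoffelC m b c).
rewrite !E (XC i h j) (XC j h i) (XC h i j) (ZC i h j) (ZC j h i) (ZC h i j); ring.
Qed.

End LeviCivita.

(** * Algebraic curvature tensors *)

Section Inner.
Context {R : realType} {n : nat} (B : 'M[R]_n).
Implicit Types u v w : 'rV[R]_n.

Lemma innerDl u v w : inner B (u + v) w = inner B u w + inner B v w.
Proof. by rewrite /inner !mulmxDl mxE. Qed.

Lemma innerZl (a : R) u w : inner B (a *: u) w = a * inner B u w.
Proof. by rewrite /inner -!scalemxAl mxE. Qed.

Hypothesis B_sym : B^T = B.

Lemma innerC u w : inner B u w = inner B w u.
Proof.
rewrite /inner; transitivity ((u *m B *m w^T)^T 0 0); first by rewrite [RHS]mxE.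
by rewrite !trmx_mul trmxK B_sym mulmxA.
Qed.

Lemma innerDr u v w : inner B w (u + v) = inner B w u + inner B w v.
Proof. by rewrite innerC innerDl !(innerC w). Qed.

Lemma innerZr (a : R) u w : inner B w (a *: u) = a * inner B w u.
Proof. by rewrite innerC innerZl innerC. Qed.

Hypothesis B_posdef : forall u, u != 0 -> 0 < inner B u u.

(* The squared length of <w,w> u - <u,w> w is <w,w> times the Gram determinant. *)
Lemma gram_gt0 u w : row_free (col_mx u w) ->
  0 < inner B u u * inner B w w - inner B u w ^+ 2.
Proof.
move=> uw_free.
have comb_neq0 (a b : R) : (a != 0) || (b != 0) -> a *: u + b *: w != 0.
  apply: contraTneq => E; have : row_mx a%:M b%:M *m col_mx u w == 0 :> 'rV_n.
    by rewrite mul_row_col !mul_scalar_mx E.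
  rewrite mulmx_free_eq0// row_mx_eq0.
  move=> /andP[/eqP/matrixP/(_ 0 0) + /eqP/matrixP/(_ 0 0)].
  by rewrite !mxE !mulr1n => -> ->; rewrite eqxx.
have w0 : w != 0.
  by have := comb_neq0 0 1; rewrite scale0r add0r scale1r; apply; rewrite oner_eq0 orbT.
have ww := B_posdef w0.
have /B_posdef : inner B w w *: u + (- inner B u w) *: w != 0.
  by apply: comb_neq0; rewrite gt_eqF.
rewrite innerDl !innerDr !innerZl !innerZr (innerC w u) => H.
rewrite -(pmulr_rgt0 _ ww); apply: lt_le_trans H _.
by apply/eqP/eqP; rewrite le_eqVlt; apply/orP; left; apply/eqP; ring.
Qed.

End Inner.

Section CurvatureTensor.
Context {R : realType} {n : nat}.
Implicit Types (M : 'I_n -> 'I_n -> 'M[R]_n) (a b c d u w : 'rV[R]_n).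

(** For M i j = g R_ij this is the curvature form <a, R(c, d) b>, so [quadri M u w u w] is the
    numerator of the sectional curvature. *)
Definition quadri M a b c d : R :=
  \sum_i \sum_j c 0 i * d 0 j * inner (M i j) a b.

Lemma quadriDl M a a' b c d :
  quadri M (a + a') b c d = quadri M a b c d + quadri M a' b c d.
Proof.
rewrite /quadri -big_split; apply: eq_bigr => i _; rewrite -big_split.
by apply: eq_bigr => j _; rewrite innerDl mulrDr.
Qed.

Lemma quadriZl M (x : R) a b c d : quadri M (x *: a) b c d = x * quadri M a b c d.
Proof.
rewrite /quadri big_distrr; apply: eq_bigr => i _; rewrite big_distrr.
by apply: eq_bigr => j _; rewrite innerZl/= mulrCA.
Qed.

Lemma quadriD3 M a b c c' d :
  quadri M a b (c + c') d = quadri M a b c d + quadri M a b c' d.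
Proof.
rewrite /quadri -big_split; apply: eq_bigr => i _; rewrite -big_split.
by apply: eq_bigr => j _; rewrite mxE/= !mulrDl.
Qed.

Lemma quadriD4 M a b c d d' :
  quadri M a b c (d + d') = quadri M a b c d + quadri M a b c d'.
Proof.
rewrite /quadri -big_split; apply: eq_bigr => i _; rewrite -big_split.
by apply: eq_bigr => j _; rewrite mxE/= mulrDr mulrDl.
Qed.

Section Antisym.
Context (M : 'I_n -> 'I_n -> 'M[R]_n).
Hypothesis M_antisym : forall i j, (M i j)^T = - M i j.

Lemma quadri_antisym a b c d : quadri M b a c d = - quadri M a b c d.
Proof.
rewrite /quadri -sumrN; apply: eq_bigr => i _; rewrite -sumrN.
apply: eq_bigr => j _; rewrite -mulrN; congr (_ * _).
transitivity ((b *m M i j *m a^T)^T 0 0); first by rewrite [RHS]mxE.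
by rewrite !trmx_mul trmxK mulmxA M_antisym mulmxN mulNmx mxE.
Qed.

Lemma quadriDr a b b' c d :
  quadri M a (b + b') c d = quadri M a b c d + quadri M a b' c d.
Proof. by rewrite quadri_antisym quadriDl opprD -!quadri_antisym. Qed.

Lemma quadriZr (x : R) a b c d : quadri M a (x *: b) c d = x * quadri M a b c d.
Proof. by rewrite quadri_antisym quadriZl -mulrN -quadri_antisym. Qed.

Lemma quadri_diag a c d : quadri M a a c d = 0.
Proof.
apply/eqP; have /eqP := quadri_antisym a a c d.
by rewrite -addr_eq0 -mulr2n mulrn_eq0.
Qed.

End Antisym.

Lemma quadri_delta M m h i j :
  quadri M (delta_mx 0 m) (delta_mx 0 h) (delta_mx 0 i) (delta_mx 0 j) = M i j m h.
Proof.
rewrite /quadri (bigD1 i)//= (bigD1 j)//= !mxE !eqxx !mul1r.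
rewrite /inner trmx_delta -rowE -colE !mxE big1 ?big1 ?addr0// => [k /negPf ki|k /negPf kj].
  by rewrite big1// => l _; rewrite !mxE ki !mul0r.
by rewrite !mxE kj mulr0 mul0r.
Qed.

(* Polarizing in u and in w, with the pair symmetry, makes M i j m h invariant
   under cyclic permutations of (h, i, j); the Bianchi identity then reads 3 M = 0. *)
Lemma curvature_tensor_eq0 M :
  (forall i j, M j i = - M i j) ->
  (forall i j, (M i j)^T = - M i j) ->
  (forall m h i j, M i j m h + M j h m i + M h i m j = 0) ->
  (forall u w, row_free (col_mx u w) -> quadri M u w u w = 0) ->
  forall i j, M i j = 0.
Proof.
move=> Mij MT bianchi M0 i j; apply/matrixP => m h; rewrite [RHS]mxE.
(* Polarization substitutes arbitrary sums, so the hypothesis must first be extended to dependent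
   pairs, where antisymmetry gives zero. *)
have {}M0 u w : quadri M u w u w = 0.
  have [/M0//|] := boolP (row_free (col_mx u w)).
  rewrite -kermx_eq0 => /rowV0Pn[x /sub_kermxP].
  rewrite -[x]hsubmxK mul_row_col [lsubmx x]mx11_scalar [rsubmx x]mx11_scalar.
  move: (lsubmx x 0 0) (rsubmx x 0 0) => p q; rewrite !mul_scalar_mx => pq0 pq.
  have pE : p *: u = - q *: w by apply/eqP; rewrite scaleNr -addr_eq0 pq0.
  have [p0|p0] := eqVneq p 0; last first.
    apply: (mulfI p0); rewrite -quadriZl pE quadriZl quadri_diag// mulr0.
    by rewrite mulr0.
  have q0 : q != 0.
    by apply: contraNneq pq => ->; rewrite p0 raddf0 row_mx0.
  have -> : w = 0.
    by move/eqP: pE; rewrite p0 scale0r eq_sym scaler_eq0 oppr_eq0 (negPf q0) => /eqP.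
  by rewrite -[X in quadri _ _ X](scale0r 0) quadriZr// mul0r.
have polar u u' w w' : quadri M u w u' w' + quadri M u w' u' w
    + quadri M u' w u w' + quadri M u' w' u w = 0.
  have bilin a a' b : quadri M a b a' b + quadri M a' b a b = 0.
    have := M0 (a + a') b; rewrite quadriDl !quadriD3 !M0 add0r addr0 => <-.
    by rewrite addrC.
  have := bilin u u' (w + w'); rewrite !quadriDr// !quadriD4.
  have := bilin u u' w; have := bilin u u' w'; lra.
have {}polar (a b c d : 'I_n) : M c d a b + M c b a d + M a d c b + M a b c d = 0.
  by have := polar (delta_mx 0 a) (delta_mx 0 c) (delta_mx 0 b) (delta_mx 0 d);
     rewrite !quadri_delta.
have {Mij}A1 (a b c d : 'I_n) : M b a c d = - M a b c d by rewrite Mij mxE.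
have {MT}A2 (a b c d : 'I_n) : M a b d c = - M a b c d.
  by have /matrixP/(_ c d) := MT a b; rewrite !mxE.
(* The octahedron argument: the Bianchi identities with fixed index a, b, c and d in turn, combined
   through the two antisymmetries, give the pair symmetry. *)
have pair (a b c d : 'I_n) : M a b c d = M c d a b.
  have := bianchi a b c d; have := bianchi b c d a.
  have := bianchi c d a b; have := bianchi d a b c.
  have := A2 c d a b; have := A2 a c d b; have := A2 d a b c; have := A1 d b c a.
  have := A2 d b a c; have := A2 b c a d; have := A1 a c d b; have := A2 a b c d.
  lra.
have cyc (a b c d : 'I_n) : M c d a b = M b c a d.
  have := polar a b c d; rewrite (pair a d c b) (pair a b c d).
  have := A1 c b a d; lra.
have := bianchi m h i j; have := cyc m h i j; have := cyc m i j h; lra.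
Qed.

End CurvatureTensor.

(** * The model tensor of constant sectional curvature *)

Section ConstantCurvature.
Context {R : realType} {n : nat}.

(* R(d_i, d_j) for constant sectional curvature c. *)
Definition space_form_mx (G : 'M[R]_n) (c : R) (i j : 'I_n) : 'M[R]_n :=
  c *: (delta_mx i 0 *m row j G - delta_mx j 0 *m row i G).

Lemma mulmx_space_form m (B : 'M[R]_(m, n)) (G : 'M[R]_n) c i j :
  B *m space_form_mx G c i j = c *: (col i B *m row j G - col j B *m row i G).
Proof. by rewrite -scalemxAr mulmxBr !mulmxA -!colE. Qed.

Lemma mul_col_rowE m k (B : 'M[R]_(m, n)) (G : 'M[R]_(n, k)) i j a b :
  (col i B *m row j G) a b = B a i * G j b.
Proof. by rewrite mxE big_ord1 !mxE. Qed.

Lemma quadri_space_form (G : 'M[R]_n) c (u w : 'rV[R]_n) : G^T = G ->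
  quadri (fun i j => G *m space_form_mx G c i j) u w u w =
  c * (inner G u u * inner G w w - inner G u w ^+ 2).
Proof.
move=> GT.
have sumE (a b : 'rV[R]_n) : inner G a b = \sum_i b 0 i * (a *m G) 0 i.
  by rewrite /inner mxE; apply: eq_bigr => i _; rewrite [b^T _ _]mxE mulrC.
have E i j : inner (G *m space_form_mx G c i j) u w =
    c * ((u *m G) 0 i * (w *m G) 0 j - (u *m G) 0 j * (w *m G) 0 i).
  have H (a b : 'I_n) : (u *m (col a G *m row b G) *m w^T) 0 0 =
      (u *m G) 0 a * (w *m G) 0 b.
    have -> : w *m G = (G *m w^T)^T by rewrite trmx_mul trmxK GT.
    rewrite mulmxA -mulmxA -row_mul colE mulmxA -colE mul_col_rowE.
    by congr (_ * _); rewrite [RHS]mxE.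
  rewrite /inner mulmx_space_form -scalemxAr -scalemxAl mxE mulmxBr mulmxBl.
  congr (_ * _); rewrite mxE; congr (_ + _); first exact: H.
  by rewrite mxE H.
rewrite /quadri expr2 {1}(innerC GT u w) !sumE !big_distrlr -sumrB big_distrr.
apply: eq_bigr => i _; rewrite -sumrB big_distrr; apply: eq_bigr => j _ /=.
rewrite E; ring.
Qed.

Lemma quadriB (M N : 'I_n -> 'I_n -> 'M[R]_n) a b c d :
  quadri (fun i j => M i j - N i j) a b c d = quadri M a b c d - quadri N a b c d.
Proof.
rewrite /quadri -sumrB; apply: eq_bigr => i _; rewrite -sumrB.
apply: eq_bigr => j _; rewrite -mulrBr; congr (_ * _).
by rewrite /inner mulmxBr mulmxBl !mxE.
Qed.

Section Metric.
Context (g : 'rV[R]_n -> 'M[R]_n) (U : set 'rV[R]_n).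
Hypothesis U_open : open U.
Hypothesis g_smooth : smooth_on U g.
Hypothesis g_sym : forall y, U y -> (g y)^T = g y.
Hypothesis g_posdef : forall y, U y -> forall u : 'rV[R]_n, u != 0 ->
  0 < (u *m g y *m u^T) 0 0.

Lemma inner_curvature_op y u w : U y ->
  inner (g y) (curvature_op g y u w) u =
  quadri (fun i j => g y *m riemann_mx g i j y) u w u w.
Proof.
move=> Uy; rewrite (innerC (g_sym Uy)) /inner mxE /quadri.
transitivity (\sum_l \sum_i \sum_j \sum_k (u *m g y) 0 l *
    (riemann g l k i j y * u 0 i * w 0 j * w 0 k)).
  apply: eq_bigr => l _; rewrite [_^T _ _]mxE [curvature_op _ _ _ _ _ _]mxE big_distrr.
  apply: eq_bigr => i _.
  by rewrite big_distrr; apply: eq_bigr => j _; rewrite big_distrr.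
rewrite exchange_big; apply: eq_bigr => i _.
rewrite exchange_big; apply: eq_bigr => j _.
rewrite exchange_big /inner mulmxA mxE big_distrr; apply: eq_bigr => k _ /=.
rewrite mxE big_distrl big_distrr; apply: eq_bigr => l _ /=.
rewrite [riemann_mx _ _ _ _ _ _]mxE [w^T _ _]mxE; ring.
Qed.

(** The Gram determinant is nonzero on independent pairs, so the quotient defining sectional
    curvature can be cleared. Conversely, R minus the model tensor, with its index lowered, has all
    the curvature symmetries and a vanishing quadratic form, hence is zero; invertibility of g
    raises the index again. *)
Lemma sectional_curvature_space_form y c : U y ->
  (forall i j, riemann_mx g i j y = space_form_mx (g y) c i j) <->
  (forall u w : 'rV[R]_n, row_free (col_mx u w) -> sectional_curvature g y u w = c).
Proof.
move=> Uy; have gT := g_sym Uy.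
have gram u w : row_free (col_mx u w) ->
    inner (g y) u u * inner (g y) w w - inner (g y) u w ^+ 2 != 0.
  by move=> uw; rewrite gt_eqF// (gram_gt0 gT)//; exact: g_posdef.
split=> [Riem u w uw|sec].
  rewrite /sectional_curvature inner_curvature_op//.
  have -> : (fun i j => g y *m riemann_mx g i j y) =
      (fun i j => g y *m space_form_mx (g y) c i j).
    by apply/funext => i; apply/funext => j; rewrite Riem.
  by rewrite quadri_space_form// mulfK// gram.
pose M i j := g y *m riemann_mx g i j y - g y *m space_form_mx (g y) c i j.
have SE i j m h : (g y *m space_form_mx (g y) c i j) m h =
    c * (g y m i * g y j h - g y m j * g y i h).
  by rewrite mulmx_space_form mxE; congr (_ * _); rewrite mxE mul_col_rowE mxE mul_col_rowE.
have sym a b := metricC g_sym a b Uy.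
suff M0 i j : M i j = 0.
  move=> i j; have /eqP := M0 i j; rewrite subr_eq0 => /eqP.
  exact/(can_inj (mulKmx (metric_unit g_posdef Uy))).
have riem_antisym i' j' : riemann_mx g j' i' y = - riemann_mx g i' j' y.
  by apply/matrixP => k h; rewrite !mxE riemannC.
have ME i' j' m h : M i' j' m h = (g y *m riemann_mx g i' j' y) m h -
    c * (g y m i' * g y j' h - g y m j' * g y i' h).
  by rewrite mxE [X in _ + X]mxE SE.
apply: curvature_tensor_eq0 => [{}i {}j|{}i {}j|m h {}i {}j|u w uw].
- apply/matrixP => m h; rewrite [RHS]mxE !ME riem_antisym mulmxN mxE; ring.
- have := riemann_mx_antisym U_open g_smooth g_sym g_posdef i j Uy.
  move=> /matrixP E; apply/matrixP => m h; rewrite mxE [RHS]mxE !ME.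
  have := E m h; rewrite mxE [RHS]mxE => ->.
  by rewrite (sym h i) (sym h j) (sym j m) (sym i m); ring.
- have B k := riemann_bianchi U_open g_smooth g_sym k h i j Uy.
  have [Q QE] : exists Q : 'I_n -> 'I_n -> 'I_n -> 'I_n -> R,
      forall k h i j, riemann g k h i j y = Q k h i j.
    by exists (fun k h i j => riemann g k h i j y).
  have MQ i' j' h' : M i' j' m h' = \sum_k g y m k * Q k h' i' j' -
      c * (g y m i' * g y j' h' - g y m j' * g y i' h').
    rewrite ME mxE; congr (_ - _); apply: eq_bigr => k _.
    by rewrite [riemann_mx _ _ _ _ _ _]mxE QE.
  have S : \sum_k g y m k * Q k h i j + \sum_k g y m k * Q k i j h
      + \sum_k g y m k * Q k j h i = 0.
    rewrite -!big_split big1// => k _ /=.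
    by rewrite -!mulrDr -!QE B mulr0.
  apply: etrans (f_equal2 +%R (f_equal2 +%R (MQ i j h) (MQ j h i)) (MQ h i j)) _.
  rewrite (sym h j) (sym i j) (sym h i).
  move: S; move: (\sum_k _) (\sum_k _) (\sum_k _) => a b d S; lra.
- rewrite quadriB quadri_space_form// -inner_curvature_op//.
  by rewrite -(sec _ _ uw) /sectional_curvature divfK ?subrr// gram.
Qed.

End Metric.
End ConstantCurvature.

(** * The Nijenhuis tensor at a point *)

Section Torsion.
Context {R : realType} {m : nat}.
Implicit Types (D : 'rV[R]_m -> 'M[R]_m) (K : 'M[R]_m) (a b u w : 'rV[R]_m).

(* The Nijenhuis tensor at a point, in terms of the value K of the almost complex
   structure and of its directional derivatives D. *)
Definition torsion D K a b : 'rV[R]_m :=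
  b *m D (a *m K) - a *m D (b *m K) + (a *m D b - b *m D a) *m K.

Lemma torsion_antisym D K a b : torsion D K b a = - torsion D K a b.
Proof. by rewrite /torsion [RHS]opprD -[- (_ *m K)]mulNmx !opprB. Qed.

(** By the Leibniz rule every derivative of [X] or [Y] occurs twice, once followed by [K z] squared;
    since this square is -1, these terms cancel and only derivatives of [K] survive. *)
Lemma nijenhuis_torsion (K : 'rV[R]_m -> 'M[R]_m) (X Y : 'rV[R]_m -> 'rV[R]_m) z :
  differentiable K z -> differentiable X z -> differentiable Y z ->
  K z *m K z = - 1%:M ->
  nijenhuis (fun x w => w *m K x) X Y z =
  torsion (fun u => 'D_u K z) (K z) (X z) (Y z).
Proof.
move=> dK dX dY K2; rewrite /nijenhuis /lie_bracket /torsion !derive_mulmx//.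
move: ('D_(X z *m K z) Y z) ('D_(X z *m K z) K z) ('D_(Y z *m K z) X z) => P1 P2 P3.
move: ('D_(Y z *m K z) K z) ('D_(Y z) X z) ('D_(Y z) K z) => P4 P5 P6.
move: ('D_(X z) Y z) ('D_(X z) K z) => P7 P8.
rewrite !mulmxBl !mulmxDl -!(mulmxA _ (K z) (K z)) !K2 !mulmxN !mulmx1.
move: (P1 *m K z) (Y z *m P2) (P3 *m K z) (X z *m P4) => Q1 Q2 Q3 Q4.
move: (X z *m P6 *m K z) (Y z *m P8 *m K z) => Q5 Q6.
apply/rowP => i; rewrite !mxE; ring.
Qed.

Section AlmostComplex.
Context D K.
Hypothesis D_linear : linear D.
Hypothesis K_sq : K *m K = - 1%:M.
Hypothesis D_sq : forall u, D u *m K + K *m D u = 0.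

Let D_add u w : D (u + w) = D u + D w.
Proof. by rewrite -[u]scale1r D_linear !scale1r. Qed.

Let D0 : D 0 = 0.
Proof. by apply: (addrI (D 0)); rewrite -D_add !addr0. Qed.

Let D_scale (x : R) u : D (x *: u) = x *: D u.
Proof. by rewrite -[x *: u]addr0 D_linear D0 addr0. Qed.

Lemma torsionDl a a' b : torsion D K (a + a') b = torsion D K a b + torsion D K a' b.
Proof.
rewrite /torsion !mulmxDl !D_add !mulmxDr !(mulmxDl, mulNmx).
by apply/rowP => i; move: (b *m D (a *m K)) (b *m D (a' *m K))
  (a *m D (b *m K)) (a' *m D (b *m K)) (a *m D b *m K) (a' *m D b *m K)
  (b *m D a *m K) (b *m D a' *m K) => *; rewrite !mxE; ring.
Qed.

Lemma torsionZl (x : R) a b : torsion D K (x *: a) b = x *: torsion D K a b.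
Proof.
rewrite /torsion -!scalemxAl !D_scale -!scalemxAr.
by rewrite scalerDr [x *: (_ *m K)]scalemxAl !scalerBr.
Qed.

Lemma torsion_suml k (a : 'I_k -> 'rV[R]_m) b :
  (forall i, torsion D K (a i) b = 0) -> torsion D K (\sum_i a i) b = 0.
Proof.
move=> a0; elim/big_ind : _ => [|u w u0 w0|i _]; last exact: a0.
- by rewrite -[X in torsion _ _ X](scale0r 0) torsionZl scale0r.
- by rewrite torsionDl u0 w0 addr0.
Qed.

(** Differentiating K^2 = -1 gives [D_sq]: each [D u] anticommutes with [K], so every factor [K] can
    be moved to the right end. *)
Lemma torsion_mull a b : torsion D K (a *m K) b = - (torsion D K a b *m K).
Proof.
have KD u : K *m D u = - (D u *m K).
  by apply/eqP; rewrite -addr_eq0 addrC D_sq.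
have aKK (c : 'rV_m) : c *m K *m K = - c by rewrite -mulmxA K_sq mulmxN mulmx1.
have aKD (c : 'rV_m) u : c *m K *m D u = - (c *m D u *m K).
  by rewrite -mulmxA KD mulmxN mulmxA.
rewrite /torsion aKK -scaleN1r D_scale scaleN1r !(mulmxDl, mulmxN, mulNmx).
rewrite !aKD !aKK mulNmx aKK.
by apply/rowP => i; move: (b *m D a) (b *m D (a *m K) *m K) (a *m D (b *m K) *m K)
  (a *m D b) => *; rewrite !mxE; ring.
Qed.

Lemma torsion_eq0 k (e : 'I_k -> 'rV[R]_m) :
  (forall a, exists x y : 'rV[R]_k,
     a = \sum_i x 0 i *: e i + (\sum_i y 0 i *: e i) *m K) ->
  (forall i j, torsion D K (e i) (e j) = 0) -> forall a b, torsion D K a b = 0.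
Proof.
move=> span e0.
have suml (x : 'rV_k) b : (forall i, torsion D K (e i) b = 0) ->
    torsion D K (\sum_i x 0 i *: e i) b = 0.
  by move=> eb; apply: torsion_suml => i; rewrite torsionZl eb scaler0.
have E a i : torsion D K a (e i) = 0.
  have [x [y ->]] := span a.
  by rewrite torsionDl torsion_mull !suml// mul0mx oppr0 addr0.
move=> a b; have [x [y ->]] := span a.
rewrite torsionDl torsion_mull !suml ?mul0mx ?oppr0 ?addr0// => i.
  by rewrite torsion_antisym E oppr0.
by rewrite torsion_antisym E oppr0.
Qed.

End AlmostComplex.
End Torsion.

(** * The almost complex structure on the cotangent bundle *)

Section LinearProjections.
Context {R : realType} {n : nat}.
Implicit Types (z w : 'rV[R]_(n + n)).

Lemma derive_comp_lsubmx (W : normedModType R) (f : 'rV[R]_n -> W) z w :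
  'D_w (fun x => f (lsubmx x)) z = 'D_(lsubmx w) f (lsubmx z).
Proof.
rewrite /derive -[in RHS](_ : (fun h : R => h^-1 *: (f (lsubmx (h *: w + z)) - f (lsubmx z)))
  = (fun h : R => h^-1 *: (f (h *: lsubmx w + lsubmx z) - f (lsubmx z))))//.
by apply/funext => h; rewrite linearP.
Qed.

Lemma derive_rsubmx z w : 'D_w (fun x : 'rV[R]_(n + n) => rsubmx x) z = rsubmx w.
Proof.
rewrite deriveE; last exact: differentiable_rsubmx.
by rewrite (@diff_lin _ _ _ rsubmx)//; exact: continuous_rsubmx.
Qed.

End LinearProjections.

Section CotangentBundle.
Context {R : realType} {n : nat} (g : 'rV[R]_n -> 'M[R]_n) (U : set 'rV[R]_n).
Hypothesis U_open : open U.
Hypothesis g_smooth : smooth_on U g.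
Hypothesis g_sym : forall y, U y -> (g y)^T = g y.
Hypothesis g_posdef : forall y, U y -> forall u : 'rV[R]_n, u != 0 ->
  0 < (u *m g y *m u^T) 0 0.
Implicit Types (z w : 'rV[R]_(n + n)) (y : 'rV[R]_n).

Local Notation e_ i := (delta_mx 0 i : 'rV[R]_n).
Local Notation Gam := (christoffel_mx g).

Let g_unit y : U y -> g y \in unitmx.
Proof. exact: metric_unit. Qed.

Let invg_sym y : U y -> (invmx (g y))^T = invmx (g y).
Proof. by move=> Uy; rewrite trmx_inv g_sym. Qed.

Lemma energy_gt0 z : U (lsubmx z) -> rsubmx z != 0 -> 0 < energy g z.
Proof.
move=> Uz p0; rewrite /energy mulr_gt0 ?invr_gt0//.
(* Raising the index of p gives a nonzero vector whose g-square is the inverse-metric square of p;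
   positivity of g then applies. *)
have q0 : rsubmx z *m invmx (g (lsubmx z)) != 0.
  apply: contra_neq p0 => /(congr1 (mulmx^~ (g (lsubmx z)))).
  by rewrite mulmxKV ?g_unit// mul0mx.
have := g_posdef Uz q0; rewrite trmx_mul invg_sym// mulmxA mulmxK ?g_unit//.
Qed.

Let gq_diff z : U (lsubmx z) -> differentiable (fun x => g (lsubmx x)) z.
Proof.
move=> Uz; apply: (differentiable_comp (differentiable_lsubmx z)).
exact: smooth_on_differentiable Uz.
Qed.

Let p_diff z : differentiable (fun x : 'rV[R]_(n + n) => rsubmx x : 'rV_n) z.
Proof. exact: differentiable_rsubmx. Qed.

Let p2 z := rsubmx z *m invmx (g (lsubmx z)) *m (rsubmx z)^T.

Let p2_diff z : U (lsubmx z) -> differentiable p2 z.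
Proof.
move=> Uz; apply: differentiable_mulmx.
  apply: differentiable_mulmx; first exact: p_diff.
  by apply: differentiable_invmx; [exact: gq_diff|exact: g_unit].
by apply: differentiable_trmx; exact: p_diff.
Qed.

Lemma energy_diff z : U (lsubmx z) -> differentiable (energy g : _ -> R^o) z.
Proof.
move=> Uz; have /differentiable_mxP/(_ 0 0) := p2_diff Uz => d.
by apply: differentiableM; [exact: differentiable_cst|exact: d].
Qed.

Lemma derive_energy z w : U (lsubmx z) ->
  'D_w (energy g : _ -> R^o) z =
  (rsubmx w *m invmx (g (lsubmx z)) *m (rsubmx z)^T) 0 0
  - 2^-1 * (rsubmx z *m (invmx (g (lsubmx z)) *m 'D_(lsubmx w) g (lsubmx z)
             *m invmx (g (lsubmx z))) *m (rsubmx z)^T) 0 0.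
Proof.
move=> Uz; have /differentiable_mxP/(_ 0 0) := p2_diff Uz => d.
have -> : (energy g : _ -> R^o) = (2^-1 : R) *: (fun x => p2 x 0 0 : R^o) by [].
rewrite deriveZ; last exact: diff_derivable.
rewrite -derive_mxE; last exact: p2_diff.
have dig : differentiable (fun x => invmx (g (lsubmx x))) z.
  by apply: differentiable_invmx; [exact: gq_diff|exact: g_unit].
have dpT := differentiable_trmx (p_diff z).
rewrite /p2 derive_mulmx//; last by apply: differentiable_mulmx.
rewrite derive_mulmx// derive_trmx// derive_rsubmx derive_invmx ?g_unit//; last exact: gq_diff.
rewrite derive_comp_lsubmx.
move: ('D_(lsubmx w) g (lsubmx z)) => D.
have E : rsubmx z *m invmx (g (lsubmx z)) *m (rsubmx w)^T =
   (rsubmx w *m invmx (g (lsubmx z)) *m (rsubmx z)^T)^T.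
  by rewrite !trmx_mul trmxK invg_sym// mulmxA.
rewrite E mulmxDl mulmxN mulNmx.
move: (rsubmx w *m _ *m _) (rsubmx z *m (_ *m _) *m _) => X Y.
by rewrite /GRing.scale/= !mxE; field.
Qed.

Lemma row_christoffel0 i z : row i (christoffel0 g z) = rsubmx z *m Gam i (lsubmx z).
Proof.
apply/rowP => h; rewrite !mxE; apply: eq_bigr => k _.
by rewrite [Gam _ _ _ _]mxE.
Qed.

(** Horizontal motion is parallel transport, an isometry: the variation of p cancels that of the
    inverse metric by [derive_metric]. *)
Lemma derive_energy_delta_q i z : U (lsubmx z) ->
  'D_(delta_q g i z) (energy g : _ -> R^o) z = 0.
Proof.
move=> Uz; rewrite derive_energy// /delta_q row_mxKl row_mxKr row_christoffel0.
rewrite (derive_metric U_open g_smooth g_sym g_posdef)//.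
have gu := g_unit Uz; have gs := invg_sym Uz.
move: (Gam i (lsubmx z)) (rsubmx z) => C p; move: (g (lsubmx z)) gu gs => G gu gs.
have -> : invmx G *m (G *m C + C^T *m G) *m invmx G = C *m invmx G + invmx G *m C^T.
  by rewrite mulmxDr mulmxDl mulKmx// -!mulmxA mulmxV// mulmx1.
have -> : p *m (C *m invmx G + invmx G *m C^T) *m p^T =
    p *m C *m invmx G *m p^T + (p *m C *m invmx G *m p^T)^T.
  by rewrite !trmx_mul trmxK gs mulmxDr mulmxDl !mulmxA.
move: (p *m C *m invmx G *m p^T) => X; by rewrite !mxE; field.
Qed.

Lemma derive_energy_vertical (u : 'rV[R]_n) z : U (lsubmx z) ->
  'D_(row_mx 0 u) (energy g : _ -> R^o) z =
  (u *m invmx (g (lsubmx z)) *m (rsubmx z)^T) 0 0.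
Proof.
move=> Uz; rewrite derive_energy// row_mxKl row_mxKr derive0.
by rewrite mulmx0 mul0mx mulmx0 mul0mx [X in _ * X]mxE mulr0 subr0.
Qed.

Section AlmostComplexStructure.
Context (A : R) (v : R -> R).
Hypothesis v_smooth : @smooth_on R R^o R^o [set t : R | 0 < t] v.
Hypothesis A_pos : 0 < A.

Local Notation G := (G_mx A v g).
Local Notation t z := (energy g z).

(** [J_domain] in pure coordinates, for A > 0 (see [J_domainP]); openness is visible in this
    form. *)
Definition J_region : set 'rV[R]_(n + n) :=
  [set z | [/\ U (lsubmx z), rsubmx z != 0 & 0 < A + 2 * v (t z)]].

Let v_diff z : J_region z -> differentiable (v : R^o -> R^o) (t z).
Proof.
by move=> [Uz p0 _]; apply: (smooth_on_differentiable v_smooth); exact: energy_gt0.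
Qed.

Let ve_diff z : J_region z -> differentiable (fun x => v (t x) : R^o) z.
Proof.
move=> zJ; have [Uz _ _] := zJ.
exact: (differentiable_comp (energy_diff Uz) (v_diff zJ)).
Qed.

Let derive_ve z w : J_region z -> 'D_w (fun x => v (t x) : R^o) z =
  'd (v : R^o -> R^o) (t z) 1 * 'D_w (energy g : _ -> R^o) z.
Proof.
move=> zJ; have [Uz _ _] := zJ.
rewrite deriveE; last exact: ve_diff.
rewrite (@diff_comp _ _ R^o R^o _ v)//=; [|exact: energy_diff|exact: v_diff].
rewrite (deriveE _ (energy_diff Uz)); move: ('d _ z w) => x.
by rewrite mulrC -[in LHS](mulr1 x); exact: linearZ.
Qed.

Lemma near_J_region z : J_region z -> \forall x \near z, J_region x.
Proof.
move=> zJ; have [Uz p0 v0] := zJ.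
have nU : \forall x \near z, U (lsubmx x).
  apply: (differentiable_continuous (differentiable_lsubmx z)).
  exact: open_nbhs_nbhs.
have np : \forall x \near z, rsubmx x != 0.
  exact: (cvgr_neq0 _ (differentiable_continuous (differentiable_rsubmx z)) p0).
have nv : \forall x \near z, 0 < A + 2 * v (t x).
  have d : differentiable (fun x => A + 2 * v (t x) : R^o) z.
    apply: differentiableD; first exact: differentiable_cst.
    by apply: differentiableM; [exact: differentiable_cst|exact: ve_diff].
  exact: (cvgr_gt _ (differentiable_continuous d) _ v0).
by apply: filterS (filterI nU (filterI np nv)) => x [? [? ?]].
Qed.

Lemma G_diff z : J_region z -> differentiable G z.
Proof.
move=> zJ; have [Uz _ _] := zJ; apply: differentiableD.
  apply: differentiable_scalemx; last exact: gq_diff.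
  by apply: differentiableM; [exact: differentiable_cst|exact: energy_diff].
apply: differentiable_scalemx; first exact: ve_diff.
apply: differentiable_mulmx; last exact: p_diff.
by apply: differentiable_trmx; exact: p_diff.
Qed.

Lemma derive_G z w : J_region z -> 'D_w G z =
  (A * 'D_w (energy g : _ -> R^o) z) *: g (lsubmx z)
  + (A * t z) *: 'D_(lsubmx w) g (lsubmx z)
  + (('d (v : R^o -> R^o) (t z) 1 * 'D_w (energy g : _ -> R^o) z)
      *: ((rsubmx z)^T *m rsubmx z)
     + v (t z) *: ((rsubmx w)^T *m rsubmx z + (rsubmx z)^T *m rsubmx w)).
Proof.
move=> zJ; have [Uz _ _] := zJ.
have dAe : differentiable (fun x => A * t x : R^o) z.
  by apply: differentiableM; [exact: differentiable_cst|exact: energy_diff].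
have dpT := differentiable_trmx (p_diff z).
have dpp : differentiable (fun x => (rsubmx x)^T *m rsubmx x) z.
  exact: differentiable_mulmx.
apply: etrans (@deriveD _ _ _ (fun x => (A * t x) *: g (lsubmx x))
  (fun x => v (t x) *: ((rsubmx x)^T *m rsubmx x)) z w _ _) _.
- by apply: diff_derivable; apply: differentiable_scalemx => //; exact: gq_diff.
- by apply: diff_derivable; apply: differentiable_scalemx => //; exact: ve_diff.
congr (_ + _).
  apply: etrans (derive_scalemx _ dAe (gq_diff Uz)) _.
  rewrite derive_comp_lsubmx; congr (_ *: _ + _).
  rewrite -[X in 'D_w X z]/(A *: (energy g : _ -> R^o)) deriveZ//.
  by apply: diff_derivable; exact: energy_diff.
apply: etrans (derive_scalemx _ (ve_diff zJ) dpp) _.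
rewrite derive_ve//; congr (_ + _ *: _).
by rewrite derive_mulmx// derive_trmx// derive_rsubmx.
Qed.

(** The energy is constant along the field, so the coefficients A t and v(t) drop out; g is handled
    by metric compatibility, and p p by the derivative p Gamma_i of p. *)
Lemma derive_G_delta_q i z : J_region z -> 'D_(delta_q g i z) G z =
  G z *m Gam i (lsubmx z) + (Gam i (lsubmx z))^T *m G z.
Proof.
move=> zJ; have [Uz _ _] := zJ; rewrite derive_G// derive_energy_delta_q// !mulr0 !scale0r.
rewrite /delta_q row_mxKl row_mxKr row_christoffel0.
rewrite (derive_metric U_open g_smooth g_sym g_posdef)//.
rewrite /G_mx; move: (Gam i _) (g _) (rsubmx z) (A * t z) (v (t z)) => C B p x y.
rewrite !add0r mulmxDl mulmxDr -!scalemxAl -!scalemxAr trmx_mul !mulmxA.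
move: (B *m C) (C^T *m B) (C^T *m p^T *m p) (p^T *m p *m C) => X Y Z W.
by apply/matrixP => a b; rewrite !mxE; ring.
Qed.

Lemma derive_G_vertical (u : 'rV[R]_n) z : J_region z ->
  let s := (u *m invmx (g (lsubmx z)) *m (rsubmx z)^T) 0 0 in
  'D_(row_mx 0 u) G z = (A * s) *: g (lsubmx z)
  + (('d (v : R^o -> R^o) (t z) 1 * s) *: ((rsubmx z)^T *m rsubmx z)
     + v (t z) *: (u^T *m rsubmx z + (rsubmx z)^T *m u)).
Proof.
move=> zJ /=; have [Uz _ _] := zJ.
by rewrite derive_G// derive_energy_vertical// row_mxKl row_mxKr derive0 scaler0 addr0.
Qed.

Lemma p_invg_p z : U (lsubmx z) ->
  rsubmx z *m invmx (g (lsubmx z)) *m (rsubmx z)^T = (2 * t z)%:M.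
Proof.
by move=> Uz; rewrite [LHS]mx11_scalar /energy /inner mulrA divff ?mul1r.
Qed.

(** The raised covector p is the special direction of G, with eigenvalue t (A + 2 v) relative to g:
    the source of the condition A + 2 v > 0. *)
Lemma G_invg_p z : U (lsubmx z) ->
  G z *m invmx (g (lsubmx z)) *m (rsubmx z)^T = (t z * (A + 2 * v (t z))) *: (rsubmx z)^T.
Proof.
move=> Uz; rewrite /G_mx 2!mulmxDl -!scalemxAl mulmxV ?g_unit// mul1mx.
rewrite -!mulmxA [rsubmx z *m (_ *m _)]mulmxA p_invg_p// mul_mx_scalar scalerA -scalerDl.
by congr (_ *: _); ring.
Qed.

Lemma mul_G (u : 'rV[R]_n) z : u *m G z =
  (A * t z) *: (u *m g (lsubmx z)) + (v (t z) * (u *m (rsubmx z)^T) 0 0) *: rsubmx z.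
Proof.
rewrite /G_mx mulmxDr -!scalemxAr mulmxA {1}[u *m (rsubmx z)^T]mx11_scalar.
by rewrite mul_scalar_mx scalerA.
Qed.

(** If u G = 0, testing against the raised p gives u p^T = 0 because A + 2 v > 0; what remains of u
    G is A t u g, which vanishes only for u = 0. *)
Lemma G_unit z : J_region z -> G z \in unitmx.
Proof.
move=> zJ; have [Uz p0 v0] := zJ; have t0 := energy_gt0 Uz p0.
rewrite -row_free_unit -kermx_eq0; apply/rowV0P => u /sub_kermxP uG.
have up : u *m (rsubmx z)^T = 0.
  have := G_invg_p Uz => /(congr1 (mulmx u)); rewrite !mulmxA uG !mul0mx -scalemxAr.
  move=> /esym/eqP; rewrite scaler_eq0 mulf_eq0 (gt_eqF t0) (gt_eqF v0)/=.
  by move/eqP.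
move: uG; rewrite mul_G up mxE mulr0 scale0r addr0 => /eqP.
rewrite scaler_eq0 mulf_eq0 (gt_eqF t0) (gt_eqF A_pos)/= => /eqP ug.
by rewrite -[u](mulmxK (g_unit Uz)) ug mul0mx.
Qed.

Definition J_mx z : 'M[R]_(n + n) :=
  invmx (adapted_frame g z) *m block_mx 0 (G z) (- invmx (G z)) 0 *m adapted_frame g z.

Lemma J_mxE : J A v g = fun z w => w *m J_mx z.
Proof. by apply/funext => z; apply/funext => w; rewrite /J /J_mx !mulmxA. Qed.

Lemma J_mx_sq z : J_region z -> J_mx z *m J_mx z = - 1%:M.
Proof.
move=> zJ; rewrite /J_mx !mulmxA mulmxK ?adapted_frame_unit// -(mulmxA (invmx _)).
rewrite mulmx_block !mulmx0 !mul0mx !addr0 !add0r mulmxN mulNmx mulmxV ?G_unit//.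
have N1 : block_mx (- 1%:M) 0 0 (- 1%:M) = - 1%:M :> 'M[R]_(n + n).
  by rewrite scalar_mx_block opp_block_mx !oppr0.
rewrite mulVmx ?G_unit// N1.
by rewrite mulmxN mulmx1 mulNmx mulVmx ?adapted_frame_unit.
Qed.

Lemma christoffel0_diff z : U (lsubmx z) -> differentiable (christoffel0 g) z.
Proof.
move=> Uz; apply/differentiable_mxP => i h.
have -> : (fun x => christoffel0 g x i h : R^o) =
    (fun x => (rsubmx x *m Gam i (lsubmx x)) 0 h).
  by apply/funext => x; rewrite -row_christoffel0 [RHS]mxE.
have : differentiable (fun x => rsubmx x *m Gam i (lsubmx x)) z.
  apply: differentiable_mulmx; first exact: p_diff.
  apply: (differentiable_comp (differentiable_lsubmx z)).
  exact: (christoffel_mx_diff U_open g_smooth g_sym g_posdef).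
by move/differentiable_mxP; apply.
Qed.

Lemma J_mx_diff z : J_region z -> differentiable J_mx z.
Proof.
move=> zJ; have [Uz _ _] := zJ.
have cst_diff (k l : nat) (B : 'M[R]_(k, l)) :
    differentiable (fun _ : 'rV[R]_(n + n) => B) z.
  exact: differentiable_cst.
have dE : differentiable (adapted_frame g) z.
  by apply: differentiable_block_mx; [exact: cst_diff|exact: christoffel0_diff
    |exact: cst_diff|exact: cst_diff].
apply: differentiable_mulmx => //; apply: differentiable_mulmx.
  by apply: differentiable_invmx => //; exact: adapted_frame_unit.
apply: differentiable_block_mx; [exact: cst_diff|exact: G_diff| |exact: cst_diff].
by apply: differentiableN; apply: differentiable_invmx; [exact: G_diff|exact: G_unit].
Qed.

Lemma delta_q_diff i z : U (lsubmx z) -> differentiable (delta_q g i) z.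
Proof.
move=> Uz; apply: differentiable_row_mx; first exact: differentiable_cst.
by apply: differentiable_mxsub; exact: christoffel0_diff.
Qed.

Lemma sum_delta_q (x : 'rV[R]_n) z :
  \sum_i x 0 i *: delta_q g i z = row_mx x (x *m christoffel0 g z).
Proof.
rewrite -[in RHS](mulmx1 x) -mulmxA mul1mx -mul_mx_row mulmx_sum_row.
by apply: eq_bigr => i _; rewrite row_row_mx row1.
Qed.

Lemma row_mx_J (x : 'rV[R]_n) z :
  row_mx x (x *m christoffel0 g z) *m J_mx z = row_mx 0 (x *m G z).
Proof.
have -> : row_mx x (x *m christoffel0 g z) = row_mx x 0 *m adapted_frame g z.
  by rewrite mul_row_block mulmx1 !mul0mx !addr0.
rewrite /J_mx !mulmxA mulmxK ?adapted_frame_unit// !mul_row_block.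
by rewrite !(mulmx0, mul0mx, addr0, add0r, mulmx1).
Qed.

Lemma delta_q_span z (a : 'rV[R]_(n + n)) : J_region z -> exists x y : 'rV[R]_n,
  a = \sum_i x 0 i *: delta_q g i z + (\sum_i y 0 i *: delta_q g i z) *m J_mx z.
Proof.
move=> zJ; pose x := lsubmx a.
exists x, ((rsubmx a - x *m christoffel0 g z) *m invmx (G z)).
rewrite !sum_delta_q row_mx_J mulmxKV ?G_unit// add_row_mx addr0 addrC subrK.
by rewrite hsubmxK.
Qed.

(** The fields delta/delta q^i and their images under J have constant d/dq components, so all their
    brackets are vertical. *)
Let lie_row_mx (M N : 'rV[R]_(n + n) -> 'rV[R]_n) (c d : 'rV[R]_n) z :
  differentiable M z -> differentiable N z ->
  lie_bracket (fun x => row_mx c (M x)) (fun x => row_mx d (N x)) z =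
  row_mx 0 ('D_(row_mx c (M z)) N z - 'D_(row_mx d (N z)) M z).
Proof.
move=> dM dN; rewrite /lie_bracket.
have E (e : 'rV[R]_n) (F : 'rV[R]_(n + n) -> 'rV[R]_n) w : differentiable F z ->
    'D_w (fun x => row_mx e (F x)) z = row_mx 0 ('D_w F z).
  by move=> dF; rewrite derive_row_mx ?derive_cst//; exact: differentiable_cst.
by rewrite (E d N _ dN) (E c M _ dM) opp_row_mx add_row_mx subr0.
Qed.

Let G_entry z i j : G z i j =
  A * t z * g (lsubmx z) i j + v (t z) * (rsubmx z 0 i * rsubmx z 0 j).
Proof. by rewrite /G_mx 3!mxE [((rsubmx z)^T *m _) _ _]mxE big_ord1 mxE. Qed.

Let row_entry (B : 'M[R]_n) (p u : 'rV[R]_n) (a b c : R) j h :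
  row j (a *: B + (b *: (p^T *m p) + c *: (u^T *m p + p^T *m u))) 0 h =
  a * B j h + (b * (p 0 j * p 0 h) + c * (u 0 j * p 0 h + p 0 j * u 0 h)).
Proof. by rewrite !mxE !big_ord1 !mxE. Qed.

(** The vertical part of [J delta_i, J delta_j]. By [G_invg_p], row i of G changes the energy at
    rate t (A + 2 v) p_i, so the v' terms are symmetric in i, j and cancel. The g term contributes A
    t (A + 2 v) and the p p term -A t v, with sum A t (A + v). *)
Lemma vertical_bracket i j z : J_region z ->
  row j ('D_(row_mx 0 (row i (G z))) G z) - row i ('D_(row_mx 0 (row j (G z))) G z) =
  rsubmx z *m space_form_mx (g (lsubmx z)) (A * t z * (A + v (t z))) i j.
Proof.
move=> zJ; have [Uz _ _] := zJ.
have sE k : (row k (G z) *m invmx (g (lsubmx z)) *m (rsubmx z)^T) 0 0 =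
    t z * (A + 2 * v (t z)) * rsubmx z 0 k.
  by rewrite -!row_mul G_invg_p// !mxE.
have GE k l : row k (G z) 0 l = A * t z * g (lsubmx z) k l
    + v (t z) * (rsubmx z 0 k * rsubmx z 0 l).
  by rewrite [LHS]mxE G_entry.
have gC := metricC g_sym i j Uz.
apply/rowP => h; rewrite !derive_G_vertical// !sE.
rewrite mulmx_space_form [LHS]mxE [(- row i _) _ _]mxE !row_entry !GE.
rewrite [RHS]mxE [X in _ = _ * X]mxE [X in _ = _ * (_ + X)]mxE !mul_col_rowE gC.
ring.
Qed.

(** The vertical part of [delta_i, delta_j]: curvature measures the failure of the horizontal
    distribution to be integrable. *)
Lemma horizontal_bracket i j z : U (lsubmx z) ->
  row i (christoffel0 g z) *m Gam j (lsubmx z) + rsubmx z *m 'D_(e_ i) (Gam j) (lsubmx z)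
  - (row j (christoffel0 g z) *m Gam i (lsubmx z)
     + rsubmx z *m 'D_(e_ j) (Gam i) (lsubmx z)) =
  rsubmx z *m riemann_mx g i j (lsubmx z).
Proof.
move=> Uz; rewrite (riemann_mxE U_open g_smooth g_sym g_posdef)// !row_christoffel0.
move: ('D_(e_ i) (Gam j) (lsubmx z)) ('D_(e_ j) (Gam i) (lsubmx z)) => P Q.
rewrite mulmxDr !mulmxBr !mulmxA.
move: (_ *m Gam j _) (rsubmx z *m P) (_ *m Gam i _) (rsubmx z *m Q) => B1 B2 B3 B4.
by apply/rowP => k; rewrite !mxE; ring.
Qed.

Lemma nijenhuis_delta_q i j z : J_region z ->
  nijenhuis (J A v g) (delta_q g i) (delta_q g j) z =
  row_mx 0 (rsubmx z *m space_form_mx (g (lsubmx z)) (A * t z * (A + v (t z))) i j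
            - rsubmx z *m riemann_mx g i j (lsubmx z)).
Proof.
move=> zJ; have [Uz _ _] := zJ.
have JE k : (fun x => J A v g x (delta_q g k x)) = (fun x => row_mx 0 (row k (G x))).
  by apply/funext => x; rewrite J_delta_q row_mx0_sum.
have dGr k : differentiable (fun x => row k (G x)) z.
  by apply: differentiable_mxsub; exact: G_diff.
have dCr k : differentiable (fun x => row k (christoffel0 g x)) z.
  by apply: differentiable_mxsub; exact: christoffel0_diff.
have dG k w : 'D_w (fun x => row k (G x)) z = row k ('D_w G z).
  by apply: derive_mxsub; exact: G_diff.
have dC k w : 'D_w (fun x => row k (christoffel0 g x)) z =
    rsubmx w *m Gam k (lsubmx z) + rsubmx z *m 'D_(lsubmx w) (Gam k) (lsubmx z).
  have -> : (fun x => row k (christoffel0 g x)) = (fun x => rsubmx x *m Gam k (lsubmx x)).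
    by apply/funext => x; rewrite row_christoffel0.
  rewrite derive_mulmx ?derive_rsubmx ?derive_comp_lsubmx//.
  apply: (differentiable_comp (differentiable_lsubmx z)).
  exact: (christoffel_mx_diff U_open g_smooth g_sym g_posdef).
rewrite /nijenhuis !JE.
rewrite (lie_row_mx _ _ (dGr i) (dGr j)).
rewrite (lie_row_mx _ _ (dGr i) (dCr j)).
rewrite (lie_row_mx _ _ (dCr i) (dGr j)).
rewrite (lie_row_mx _ _ (dCr i) (dCr j)).
rewrite !dG !dC !derive_G_delta_q//.
rewrite !row_mxKr !row_mxKl !derive0 !mulmx0 !addr0.
have rowM k l (B : 'M[R]_n) : row k (G z *m B + (Gam l (lsubmx z))^T *m G z) =
   row k (G z) *m B + row k (Gam l (lsubmx z))^T *m G z.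
  by rewrite -!row_mul -linearD.
(* Symmetry of the Christoffel symbols makes [J delta_i, delta_j] and [delta_i, J delta_j] opposite,
   so the terms under J cancel. *)
have rowT : row j (Gam i (lsubmx z))^T = row i (Gam j (lsubmx z))^T.
  by apply/rowP => k; rewrite !mxE (christoffelC U_open g_smooth g_sym).
rewrite !rowM rowT horizontal_bracket// vertical_bracket//.
rewrite opprD addNKr (addrAC (row j _ *m _)) subrr add0r.
rewrite J_mxE -[X in row_mx X (- _)]oppr0 -opp_row_mx mulNmx opprK addrK.
by rewrite opp_row_mx add_row_mx subr0.
Qed.

Lemma nijenhuis_J (X Y : 'rV[R]_(n + n) -> 'rV[R]_(n + n)) z : J_region z ->
  differentiable X z -> differentiable Y z ->
  nijenhuis (J A v g) X Y z = torsion (fun u => 'D_u J_mx z) (J_mx z) (X z) (Y z).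
Proof.
move=> zJ dX dY; rewrite J_mxE nijenhuis_torsion//; first exact: J_mx_diff.
exact: J_mx_sq.
Qed.

Lemma torsion_eq0_curvature z : J_region z ->
  (forall a b, torsion (fun u => 'D_u J_mx z) (J_mx z) a b = 0) <->
  (forall i j, rsubmx z *m riemann_mx g i j (lsubmx z) =
     rsubmx z *m space_form_mx (g (lsubmx z)) (A * t z * (A + v (t z))) i j).
Proof.
move=> zJ; have [Uz _ _] := zJ.
have E i j := nijenhuis_J zJ (delta_q_diff i Uz) (delta_q_diff j Uz).
have {}E i j := etrans (esym (E i j)) (nijenhuis_delta_q i j zJ).
have dK := J_mx_diff zJ.
split=> [T0 i j|RE].
  have := E i j; rewrite T0 => /(congr1 rsubmx); rewrite row_mxKr linear0.
  by move=> /esym/eqP; rewrite subr_eq0 => /eqP.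
apply: (@torsion_eq0 _ _ _ _ _ _ _ _ (delta_q g ^~ z)).
- by move=> x u w; rewrite !deriveE// linearP.
- exact: J_mx_sq.
(* The square of J is the constant -1 on a whole neighbourhood of [z], so its derivative
   vanishes. *)
- move=> u; rewrite -derive_mulmx// (@near_eq_derive _ _ _ _ (cst (- 1%:M))).
    exact: derive_cst.
  by apply: filterS (near_J_region zJ) => x xJ; rewrite J_mx_sq.
- by move=> a; exact: delta_q_span.
- by move=> i j; rewrite E RE subrr row_mx0.
Qed.

End AlmostComplexStructure.
End CotangentBundle.

(** * Charts *)

Section Transition.
Context {R : realType} {n : nat} {M : topologicalType} (S : smooth_manifold R n M).
Implicit Types (a b c : chart_index S) (x : M).

Lemma transition_differentiable a b x : chart_dom a x -> chart_dom b x ->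
  differentiable (chart b \o chart_inv a) (chart a x).
Proof.
move=> ax bx; apply: (smooth_on_differentiable (transition_smooth a b)).
by exists x.
Qed.

Lemma mul_transition_jacobian a b x (u : 'rV[R]_n) :
  chart_dom a x -> chart_dom b x ->
  u *m transition_jacobian a b x = 'D_u (chart b \o chart_inv a) (chart a x).
Proof.
by move=> ax bx; rewrite deriveEjacobian//; exact: transition_differentiable.
Qed.

Lemma transition_jacobian_refl a x : chart_dom a x -> transition_jacobian a a x = 1%:M.
Proof.
move=> ax; apply/row_matrixP => i.
rewrite !rowE mul_transition_jacobian// mulmx1.
rewrite (@near_eq_derive _ _ _ _ id) ?derive_id//.
have : nbhs (chart a x) (chart a @` chart_dom a).
  by apply: open_nbhs_nbhs; split; [exact: chart_image_open|exists x].
by apply: filterS => _ [y ay <-] /=; rewrite chart_cancel.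
Qed.

(** The chain rule applies because, by continuity of [chart_inv a], the transition from a to c
    factors through chart b near the point. *)
Lemma transition_jacobian_comp a b c x :
  chart_dom a x -> chart_dom b x -> chart_dom c x ->
  transition_jacobian a b x *m transition_jacobian b c x = transition_jacobian a c x.
Proof.
move=> ax bx cx; apply/row_matrixP => i.
apply: etrans (rowE _ _) _; apply: etrans (mulmxA _ _ _) _.
apply: etrans (congr1 (mulmx^~ _) (mul_transition_jacobian _ ax bx)) _.
apply: etrans (mul_transition_jacobian _ bx cx) _.
apply: esym; apply: etrans (rowE _ _) _.
apply: etrans (mul_transition_jacobian _ ax cx) _.
have dab := transition_differentiable ax bx.
have dbc := transition_differentiable bx cx.
have E : (chart b \o chart_inv a) (chart a x) = chart b x.
  by rewrite /= chart_cancel.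
rewrite -E in dbc *.
have near_ac : \forall y \near chart a x, (chart c \o chart_inv a) y =
    ((chart c \o chart_inv b) \o (chart b \o chart_inv a)) y.
  have : \forall y \near chart a x, chart_dom b (chart_inv a y).
    apply: (chart_inv_continuous (a := a)); first by exists x.
    rewrite chart_cancel//; apply: open_nbhs_nbhs; split => //.
    exact: chart_dom_open.
  by apply: filterS => y by_ /=; rewrite chart_cancel.
apply: etrans (near_eq_derive _ near_ac) _.
have -> := deriveE (delta_mx 0 i) (differentiable_comp dab dbc).
have -> := deriveE (delta_mx 0 i) dab.
have -> := deriveE ('d (chart b \o chart_inv a) (chart a x) (delta_mx 0 i)) dbc.
exact: (congr1 (fun h => h (delta_mx 0 i)) (diff_comp dab dbc)).
Qed.

(** Makes the fibres of [J_domain] full: components in other charts are defined by transport from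
    chart [a], and the cocycle rule for Jacobians yields the change law. *)
Lemma cotangent_ext a x (p : 'rV[R]_n) : chart_dom a x ->
  exists P : cotangent S, ct_base P = x /\ ct_comp P a = p.
Proof.
move=> ax.
pose comp b := if `[< chart_dom b x >] then p *m (transition_jacobian b a x)^T else 0.
have compE b : chart_dom b x -> comp b = p *m (transition_jacobian b a x)^T.
  by move=> bx; rewrite /comp asboolT.
have change b c : chart_dom b x -> chart_dom c x ->
    comp b = comp c *m (transition_jacobian b c x)^T.
  move=> bx cx; apply: etrans (compE b bx) _.
  apply: etrans (congr1 (mulmx^~ _) (esym (compE c cx))); rewrite -mulmxA -trmx_mul.
  exact: (congr1 (fun B : 'M[R]_n => p *m B^T) (esym (transition_jacobian_comp bx cx ax))).
have out b : ~ chart_dom b x -> comp b = 0 by move=> bx; rewrite /comp asboolF.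
exists (@Build_cotangent _ _ _ S x comp change out); split=> //=.
by rewrite (compE a ax) (transition_jacobian_refl ax) trmx1 mulmx1.
Qed.

Lemma J_domainP (g : riemannian_metric S) (A : R) (v : R -> R) a z : 0 < A ->
  J_domain g A v a z <-> J_region (metric_mx g a) (chart a @` chart_dom a) A v z.
Proof.
move=> A0; split=> [[P [aP [b Pb0] _ v0] <-]|[[x ax xz] p0 v0]].
  rewrite /J_region/= /ct_chart row_mxKl row_mxKr; split=> //; first by exists (ct_base P).
  (* [ct_nonzero] may be witnessed in another chart. The change law transfers it to chart [a], and a
     chart missing the base point cannot be a witness because its components are 0. *)
  have [bP|bP] := pselect (chart_dom b (ct_base P)).
    by apply: contra_neq Pb0; rewrite (ct_change bP aP) => ->; rewrite mul0mx.
  by rewrite ct_out ?eqxx in Pb0.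
have [P [Px Pa]] := cotangent_ext (rsubmx z) ax.
have Pz : ct_chart a P = z by rewrite /ct_chart Px Pa xz hsubmxK.
by exists P => //; split; rewrite ?Px ?Pz//; exists a; rewrite Pa.
Qed.

End Transition.

Lemma smooth_on_cst (R : realType) (V W : normedModType R) (U : set V) (w : W) :
  smooth_on U (fun=> w).
Proof.
move=> k; elim: k w => [|k IHk] w /=; first by move=> x _; exact: cst_continuous.
split=> [x _|u]; first exact: differentiable_cst.
have -> : (fun x => 'D_u (fun=> w) x) = (fun=> 0 : W); last exact: IHk.
by apply/funext => x; exact: derive_cst.
Qed.

Section MetricInChart.
Context {R : realType} {n : nat} {M : topologicalType} {S : smooth_manifold R n M}.
Context (g : riemannian_metric S) (a : chart_index S).
Local Notation U := (chart a @` chart_dom a).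
Local Notation ga := (metric_mx g a).

Lemma chart_metric_sym y : U y -> (ga y)^T = ga y.
Proof. by move=> [x ax <-]; exact: (Defs.metric_sym g ax). Qed.

Lemma chart_metric_posdef y : U y -> forall u : 'rV[R]_n, u != 0 ->
  0 < (u *m ga y *m u^T) 0 0.
Proof. by move=> [x ax <-]; exact: (metric_posdef g ax). Qed.

End MetricInChart.

(** * Identification of the curvature constant and of v *)

Lemma energy_scale (R : realType) n (g : 'rV[R]_n -> 'M[R]_n) (y p : 'rV[R]_n) (s : R) :
  energy g (row_mx y (s *: p)) = s ^+ 2 * energy g (row_mx y p).
Proof.
rewrite /energy !row_mxKl !row_mxKr /inner linearZ /= -!scalemxAl -scalemxAr scalerA.
by rewrite mxE; ring.
Qed.

(** If the constants differed, then p_i e_j = p_j e_i for all i, j after cancelling G; reading entry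
    j for some j != i gives p_i = 0. In dimension 1 no such j exists, and the model tensor is zero
    for every constant. *)
Lemma mul_space_form_inj (R : realType) n (G : 'M[R]_n) (c c' : R) (p : 'rV[R]_n) :
  (2 <= n)%N -> G \in unitmx -> p != 0 ->
  (forall i j, p *m space_form_mx G c i j = p *m space_form_mx G c' i j) -> c = c'.
Proof.
move=> n2 Gu p0 E; apply/eqP; apply: contraNT p0 => cc'.
apply/eqP/rowP => i; rewrite [RHS]mxE.
have [j ji] : exists j : 'I_n, j != i.
  have [->|] := eqVneq i (Ordinal (ltnW n2 : (0 < n)%N)); first by exists (Ordinal n2).
  by rewrite eq_sym => ni; exists (Ordinal (ltnW n2)).
have /eqP := E i j; rewrite !mulmx_space_form -subr_eq0 -scalerBl scaler_eq0 subr_eq0.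
rewrite (negPf cc')/= => /eqP H.
have : (p 0 i *: delta_mx 0 j - p 0 j *: delta_mx 0 i : 'rV_n) *m G = 0.
  rewrite mulmxBl -!scalemxAl -!rowE -[RHS]H; congr (_ - _).
    by rewrite [col i p]mx11_scalar mul_scalar_mx mxE.
  by rewrite [col j p]mx11_scalar mul_scalar_mx mxE.
move=> /(congr1 (mulmx^~ (invmx G))); rewrite mulmxK// mul0mx => /rowP/(_ j).
by rewrite !mxE eqxx (negPf ji) eqxx mulr1 mulr0 subr0.
Qed.

Lemma space_form_of_integrable (R : realType) n (M : topologicalType)
    (S : smooth_manifold R n M) (g : riemannian_metric S) (A : R) (v : R -> R) a z :
  0 < A -> @smooth_on R R^o R^o [set t : R | 0 < t] v ->
  J_integrable g A v ->
  J_region (metric_mx g a) (chart a @` chart_dom a) A v z -> forall i j,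
  rsubmx z *m riemann_mx (metric_mx g a) i j (lsubmx z) =
  rsubmx z *m space_form_mx (metric_mx g a (lsubmx z))
    (A * energy (metric_mx g a) z * (A + v (energy (metric_mx g a) z))) i j.
Proof.
move=> A0 vs Jint zJ.
apply/(torsion_eq0_curvature (@chart_image_open _ _ _ S a) (metric_smooth g a)
  (chart_metric_sym g (a := a)) (chart_metric_posdef g (a := a)) vs A0 zJ) => b c.
have /(@J_domainP _ _ _ _ g A v a z A0) zD := zJ.
(* Constant fields are smooth on the domain and take the prescribed values [b] and [c] at [z]. *)
have := Jint a _ _ (@smooth_on_cst _ _ _ _ b) (@smooth_on_cst _ _ _ _ c) z zD.
apply: etrans; apply/esym.
exact: (nijenhuis_J (@chart_image_open _ _ _ S a) (metric_smooth g a)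
  (chart_metric_sym g (a := a)) (chart_metric_posdef g (a := a)) vs A0 zJ
  (differentiable_cst _ _) (differentiable_cst _ _)).
Qed.

Lemma scale_to_energy (R : realType) n (g : 'rV[R]_n -> 'M[R]_n) (y p : 'rV[R]_n) (t : R) :
  0 < energy g (row_mx y p) -> 0 < t ->
  exists2 s : R, 0 < s & energy g (row_mx y (s *: p)) = t.
Proof.
move=> e0 t0; exists (Num.sqrt (t / energy g (row_mx y p))).
  by rewrite sqrtr_gt0 divr_gt0.
by rewrite energy_scale sqr_sqrtr ?divfK ?gt_eqF// ltW// divr_gt0.
Qed.

Theorem theorem3 (R : realType) (n : nat) (M : topologicalType)
    (S : smooth_manifold R n M) (g : riemannian_metric S)
    (A : R) (v : R -> R)
    (n_ge2 : (2 <= n)%N)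
    (M_nonempty : [set: M] !=set0)
    (v_smooth : @smooth_on R R^o R^o [set t : R | 0 < t] v)
    (A_pos : 0 < A)
    (J_defined_somewhere : exists t : R, 0 < t /\ 0 < A + 2 * v t) :
  J_integrable g A v <->
  exists c : R,
    constant_sectional_curvature g c /\
    (forall t : R, 0 < t -> 0 < A + 2 * v t ->
       v t = (c - A ^+ 2 * t) / (A * t)).
Proof.
have sym a := chart_metric_sym g (a := a).
have pos a := chart_metric_posdef g (a := a).
have [t0 [t0_pos vt0]] := J_defined_somewhere.
split=> [Jint|[c [sec vE]] a X Y Xs Ys z zD].
  pose c := A * t0 * (A + v t0); exists c.
  (* Here [p] and [t] are decoupled: the identity is used at the multiple of [p] with energy [t],
     and the factor is cancelled by linearity. *)
  have curv a y (p : 'rV[R]_n) (t : R) : (chart a @` chart_dom a) y -> p != 0 ->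
      0 < t -> 0 < A + 2 * v t -> forall i j,
      p *m riemann_mx (metric_mx g a) i j y =
      p *m space_form_mx (metric_mx g a y) (A * t * (A + v t)) i j.
    move=> Uy p0 tpos vt i j.
    have e0 : 0 < energy (metric_mx g a) (row_mx y p).
      by apply: (energy_gt0 (sym a) (pos a)); rewrite ?row_mxKl ?row_mxKr.
    have [s s0 sE] := scale_to_energy e0 tpos.
    have zJ : J_region (metric_mx g a) (chart a @` chart_dom a) A v (row_mx y (s *: p)).
      by split; rewrite ?row_mxKl ?row_mxKr ?sE// scaler_eq0 negb_or gt_eqF.
    have := space_form_of_integrable A_pos v_smooth Jint zJ i j.
    rewrite row_mxKl row_mxKr sE -!scalemxAl => /scalerI; apply.
    by rewrite gt_eqF.
  split=> [a x ax|t tpos vt].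
    have Ux : (chart a @` chart_dom a) (chart a x) by exists x.
    apply/(sectional_curvature_space_form (@chart_image_open _ _ _ S a) (metric_smooth g a)
      (sym a) (pos a) c Ux) => i j.
    (* Basis covectors taken as [p], all at level [t0], yield the rows of R. *)
    apply/row_matrixP => k; rewrite !rowE; apply: curv => //.
    by apply/eqP => /matrixP/(_ 0 k)/eqP; rewrite !mxE !eqxx oner_eq0.
  have [x _] := M_nonempty; have [a ax] := chart_dom_cover S x.
  have Ux : (chart a @` chart_dom a) (chart a x) by exists x.
  pose p : 'rV[R]_n := delta_mx 0 (Ordinal (ltnW n_ge2)).
  have p0 : p != 0.
    by apply/eqP => /matrixP/(_ 0 (Ordinal (ltnW n_ge2)))/eqP; rewrite !mxE !eqxx oner_eq0.
  (* For one fixed [p] the curvature side is the same at the levels [t0] and [t], so the two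
     coefficients agree. *)
  have ct : c = A * t * (A + v t).
    apply: (mul_space_form_inj n_ge2 (posdef_unitmx (pos a _ Ux)) p0) => i j.
    by rewrite -!curv.
  by rewrite ct; field; rewrite !gt_eqF.
have /(@J_domainP _ _ _ _ g A v a z A_pos) zJ := zD.
have [Uz p0 vz] := zJ.
have dX := (Xs 1%N).1 z zD; have dY := (Ys 1%N).1 z zD.
apply: etrans (nijenhuis_J (@chart_image_open _ _ _ S a) (metric_smooth g a) (sym a) (pos a)
  v_smooth A_pos zJ dX dY) _.
apply: (torsion_eq0_curvature (@chart_image_open _ _ _ S a) (metric_smooth g a)
  (sym a) (pos a) v_smooth A_pos zJ).2 => i j.
have tpos := energy_gt0 (sym a) (pos a) Uz p0.
have -> : A * energy (metric_mx g a) z * (A + v (energy (metric_mx g a) z)) = c.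
  by rewrite (vE _ tpos vz); field; rewrite !gt_eqF.
congr (_ *m _); move: i j.
apply/(sectional_curvature_space_form (@chart_image_open _ _ _ S a) (metric_smooth g a)
  (sym a) (pos a) c Uz).
by case: Uz => x ax <-; exact: sec.
Qed.
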